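(* Let $1\le p\le\infty$, $m\ge1$, and let $k_1,\ldots,k_n$ be non-negative integers with $k_1+\cdots+k_n=m$. Then, if $p\ge m$, \[\frac{k_1!\cdots k_n!}{k_1^{k_1/p}\cdots k_n^{k_n/p}}\,\frac{m^{m/p}}{m!}\le c_p(k_1,\ldots,k_n)\le \min\left\{\frac{k_1^{k_1}\cdots k_n^{k_n}}{m!}\,n^{m/p},\ \frac{p\,2^{p/2}\Gamma(p/2)\,m^{p/2}}{m!}\right\},\] and, if $p<m$, \[\frac{k_1!\cdots k_n!}{k_1^{k_1/p}\cdots k_n^{k_n/p}}\,\frac{m^{m/p}}{m!}\le c_p(k_1,\ldots,k_n)\le \min\left\{\frac{k_1^{k_1}\cdots k_n^{k_n}}{m!}\,n^{m/p},\ \frac{n^{(m-p)/p}\,m\,2^{m/2}\Gamma(m/2)\,m^{m/2}}{m!}\right\}.\]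
   Context: $c_p(k_1,\ldots,k_n)$ denotes the smallest constant $c$ such that for every continuous symmetric $m$-linear form $L:(\ell_p)^m\to\mathbb{R}$ on real $\ell_p$ and all norm-one vectors $x_1,\ldots,x_n\in\ell_p$ with pairwise disjoint supports, $|L(x_1^{k_1}\cdots x_n^{k_n})|\le c\,\|\widehat L\|$. Here $\widehat{L}(x)=L(x,\ldots,x)$, $\|\widehat{L}\|=\sup\{|\widehat{L}(x)|:\|x\|_p\le1\}$, and $L(x_1^{k_1}\cdots x_n^{k_n})$ means $L$ evaluated at the $m$-tuple in which each $x_i$ appears $k_i$ times. Conventions: $0^0=1$, $0!=1$; when $p=\infty$, $k^{k/p}=1$, $m^{m/p}=n^{m/p}=1$, and $p\,2^{p/2}\Gamma(p/2)m^{p/2}$ is interpreted as $+\infty$. *)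

(* Defs.v *)
From Stdlib Require Import Factorial Reals Lra List Permutation Classical ClassicalEpsilon.
Open Scope R_scope.

Inductive extp : Type := PFin (r : R) | PInf.

Definition p_valid (p : extp) : Prop :=
  match p with PFin r => 1 <= r | PInf => True end.

Definition rpow (a s : R) : R :=
  if Req_EM_T a 0 then (if Req_EM_T s 0 then 1 else 0) else Rpower a s.

Definition ppow (p : extp) (a e : R) : R :=
  match p with PFin r => rpow a (e / r) | PInf => 1 end.

Definition vec := nat -> R.

Definition lp_norm_is (p : extp) (x : vec) (r : R) : Prop :=
  0 <= r /\
  match p with
  | PFin q => infinite_sum (fun i => rpow (Rabs (x i)) q) (rpow r q)
  | PInf => is_lub (fun t => exists i, t = Rabs (x i)) r
  end.

Definition in_lp (p : extp) (x : vec) : Prop := exists r, lp_norm_is p x r.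

Definition vsub (x y : vec) : vec := fun t => x t - y t.
Definition vlin (a : R) (u : vec) (b : R) (v : vec) : vec := fun t => a * u t + b * v t.

(* m-ary forms act on lists of vectors of length m (only values on
   m-tuples of l_p vectors matter). *)
Definition form := list vec -> R.

Definition args_ok (p : extp) (m : nat) (l : list vec) : Prop :=
  length l = m /\ Forall (in_lp p) l.

Definition multilinear (p : extp) (m : nat) (L : form) : Prop :=
  forall (a b : list vec) (u v : vec) (al be : R),
    (length a + S (length b))%nat = m ->
    Forall (in_lp p) a -> Forall (in_lp p) b -> in_lp p u -> in_lp p v ->
    L (a ++ vlin al u be v :: b) = al * L (a ++ u :: b) + be * L (a ++ v :: b).

Definition symmetric_form (p : extp) (m : nat) (L : form) : Prop :=
  forall l l', args_ok p m l -> Permutation l l' -> L l = L l'.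

Definition continuous_form (p : extp) (m : nat) (L : form) : Prop :=
  forall l, args_ok p m l -> forall eps, 0 < eps -> exists delta, 0 < delta /\
    forall l', args_ok p m l' ->
      Forall2 (fun y x => exists r, lp_norm_is p (vsub y x) r /\ r < delta) l' l ->
      Rabs (L l' - L l) < eps.

Definition sym_mlin_form (p : extp) (m : nat) (L : form) : Prop :=
  multilinear p m L /\ symmetric_form p m L /\ continuous_form p m L.

(* the set { |L^(x)| : ||x||_p <= 1 } ; its least upper bound is ||L^|| *)
Definition hat_values (p : extp) (m : nat) (L : form) (t : R) : Prop :=
  exists x r, lp_norm_is p x r /\ r <= 1 /\ t = Rabs (L (repeat x m)).

Definition sumk (n : nat) (k : nat -> nat) : nat :=
  fold_right Nat.add 0%nat (map k (seq 0 n)).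

Definition prodR (n : nat) (f : nat -> R) : R :=
  fold_right Rmult 1 (map f (seq 0 n)).

Definition args_of (n : nat) (k : nat -> nat) (x : nat -> vec) : list vec :=
  flat_map (fun i => repeat (x i) (k i)) (seq 0 n).

Definition disjoint_supports (n : nat) (x : nat -> vec) : Prop :=
  forall i j, (i < n)%nat -> (j < n)%nat -> i <> j ->
    forall t, x i t = 0 \/ x j t = 0.

Definition admissible (p : extp) (n : nat) (k : nat -> nat) (c : R) : Prop :=
  forall L, sym_mlin_form p (sumk n k) L ->
  forall N, is_lub (hat_values p (sumk n k) L) N ->
  forall x : nat -> vec,
    (forall i, (i < n)%nat -> lp_norm_is p (x i) 1) ->
    disjoint_supports n x ->
    Rabs (L (args_of n k x)) <= c * N.

Definition is_cp (p : extp) (n : nat) (k : nat -> nat) (c : R) : Prop :=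
  admissible p n k c /\ forall c', admissible p n k c' -> c <= c'.

(* Gamma function for s > 0 via Gauss' limit formula:
   Gamma(s) = lim_N N^s N! / (s (s+1) ... (s+N)). *)
Definition gauss_seq (s : R) (N : nat) : R :=
  Rpower (INR N) s * INR (fact N) / prodR (S N) (fun j => s + INR j).

Definition Gamma (s : R) : R :=
  epsilon (inhabits 0) (fun l => Un_cv (gauss_seq s) l).

Definition lower_bound (p : extp) (n : nat) (k : nat -> nat) (m : nat) : R :=
  prodR n (fun i => INR (fact (k i))) / prodR n (fun i => ppow p (INR (k i)) (INR (k i)))
  * ppow p (INR m) (INR m) / INR (fact m).

Definition upper_A (p : extp) (n : nat) (k : nat -> nat) (m : nat) : R :=
  prodR n (fun i => INR (k i) ^ (k i)) / INR (fact m) * ppow p (INR n) (INR m).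

Definition upper_bound (p : extp) (n : nat) (k : nat -> nat) (m : nat) : R :=
  match p with
  | PInf => upper_A p n k m  (* second term of the min is +oo *)
  | PFin r =>
      if Rle_dec (INR m) r then
        Rmin (upper_A p n k m)
             (r * rpow 2 (r / 2) * Gamma (r / 2) * rpow (INR m) (r / 2) / INR (fact m))
      else
        Rmin (upper_A p n k m)
             (rpow (INR n) ((INR m - r) / r) * INR m * rpow 2 (INR m / 2)
              * Gamma (INR m / 2) * rpow (INR m) (INR m / 2) / INR (fact m))
  end.

(* Main.v *)
Require Import Defs.
From Stdlib Require Import Arith Reals Lra Lia List Permutation Classical ClassicalEpsilon FunctionalExtensionality.
Open Scope R_scope.

(* Upper bounds: on the span of the disjointly supported x_1, ..., x_n, the l_p norm of
   sum_i a_i x_i is the l_p norm of a, so L can be pulled back to coefficient vectors and expanded by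
   the polarization formula m! L(y_1, ..., y_m) = E[e_1 ... e_m L^(sum_j e_j y_j)]. Taking
   y_j = x_i / k_i in block i keeps all signed sums in the sup-norm unit ball and gives the first
   bound. Taking y_j = x_i gives the mean of (sum_i |s_i|^p)^(m/p), with s_i a sum of k_i signs; this
   is compared with sum_i |s_i|^m by monotonicity of l_p norms (p >= m) or by the power mean
   inequality (p < m), and the moments of order m are bounded by Khinchine's inequality, whose
   constant m 2^(m/2) Gamma(m/2) satisfies the recursion given by the integration by parts
   E|s|^(m+2) <= (m+1) k E|s|^m. For p >= m, passing from m to p in the constant uses
   s Gamma(s) s^d <= (s+d) Gamma(s+d).
   Lower bound: the polar form of the monomial X_1^(k_1) ... X_n^(k_n) at the unit vectors; its norm
   is bounded by the weighted inequality of means, in the form ln u <= u - 1. *)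

(** The exponent m is forced in the second bound: a mean over signs passes through sum_i |s_i|^m
    term by term, so that Khinchine's inequality applies to each coordinate, but it does not pass
    through the power m/p of a sum. The constant m 2^(m/2) Gamma(m/2) is the integral of 2 m t^(m-1)
    e^(-t^2/2) over t > 0, the value that the tail bound 2 e^(-t^2/2) for normalized sign sums gives
    for their m-th moment. Neither tails nor integrals occur below: the constant enters only through
    a recursion in steps of two and lower estimates at m = 1 and m = 2. [Gamma] is picked by
    [epsilon], so it carries no information until Gauss' sequence is known to converge; afterwards
    every property of it is a limit of a property of that sequence. The least constant itself has to
    be constructed: the infimum of the admissible constants is shown to be admissible. *)

(** * Finite sums and products *)

Fixpoint rsum (n : nat) (f : nat -> R) : R :=
  match n with O => 0 | S n => rsum n f + f n end.

Lemma rsum_ext n f g : (forall i, (i < n)%nat -> f i = g i) -> rsum n f = rsum n g.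
Proof.
  induction n as [|n IH]; intros H; [easy|].
  simpl. rewrite IH by (intros; apply H; lia). now rewrite H by lia.
Qed.

Lemma rsum_le n f g : (forall i, (i < n)%nat -> f i <= g i) -> rsum n f <= rsum n g.
Proof.
  induction n as [|n IH]; intros H; simpl; [lra|].
  apply Rplus_le_compat; [apply IH; intros|]; apply H; lia.
Qed.

Lemma rsum_nonneg n f : (forall i, (i < n)%nat -> 0 <= f i) -> 0 <= rsum n f.
Proof.
  intros H. replace 0 with (rsum n (fun _ => 0)); [now apply rsum_le|].
  clear; induction n as [|n IH]; simpl; lra.
Qed.

Lemma rsum_scal n c f : rsum n (fun i => c * f i) = c * rsum n f.
Proof. induction n as [|n IH]; simpl; lra. Qed.

Lemma rsum_const n c : rsum n (fun _ => c) = INR n * c.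
Proof. induction n as [|n IH]; [simpl; lra|]. rewrite S_INR; simpl; lra. Qed.

Lemma rsum_lin n al be f g :
  rsum n (fun i => al * f i + be * g i) = al * rsum n f + be * rsum n g.
Proof. induction n as [|n IH]; simpl; lra. Qed.

Lemma rsum_term_le n f i :
  (forall j, (j < n)%nat -> 0 <= f j) -> (i < n)%nat -> f i <= rsum n f.
Proof.
  induction n as [|n IH]; intros H Hi; [lia|]. simpl.
  destruct (Nat.eq_dec i n) as [->|Hn].
  - assert (0 <= rsum n f) by (apply rsum_nonneg; intros; apply H; lia). lra.
  - assert (f i <= rsum n f) by (apply IH; [intros; apply H; lia|lia]).
    assert (0 <= f n) by (apply H; lia). lra.
Qed.

Lemma rsum_swap n f : rsum n (fun i => rsum n (f i)) = rsum n (fun j => rsum n (fun i => f i j)).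
Proof.
  enough (H : forall a b, rsum a (fun i => rsum b (f i)) = rsum b (fun j => rsum a (fun i => f i j)))
    by apply H.
  intros a b. induction a as [|a IH]; simpl.
  - rewrite rsum_const; lra.
  - rewrite IH.
    rewrite (rsum_ext b (fun j => rsum a (fun i => f i j) + f a j)
               (fun j => 1 * rsum a (fun i => f i j) + 1 * f a j)) by (intros; lra).
    rewrite (rsum_lin b 1 1 (fun j => rsum a (fun i => f i j)) (f a)). lra.
Qed.

(** [j] may lie outside the range, because [disjoint_single] supplies an index without the guarantee
    that it is below [n]. *)
Lemma rsum_single n f j :
  (forall i, (i < n)%nat -> i <> j -> f i = 0) ->
  rsum n f = if lt_dec j n then f j else 0.
Proof.
  induction n as [|n IH]; intros H; simpl; [easy|].
  rewrite IH by (intros; apply H; lia).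
  destruct (Nat.eq_dec j n) as [->|Hj].
  - destruct (lt_dec n n); [lia|]. destruct (lt_dec n (S n)); [lra|lia].
  - rewrite (H n) by lia. destruct (lt_dec j n), (lt_dec j (S n)); try lia; lra.
Qed.

Lemma prodR_S n f : prodR (S n) f = prodR n f * f n.
Proof.
  unfold prodR. rewrite seq_S, map_app, fold_right_app. simpl.
  induction (map f (seq 0 n)) as [|a l IH]; simpl; [ring|]. rewrite IH. ring.
Qed.

Lemma prodR_ext n f g : (forall i, (i < n)%nat -> f i = g i) -> prodR n f = prodR n g.
Proof.
  induction n as [|n IH]; intros H; [easy|].
  rewrite !prodR_S, IH by (intros; apply H; lia). now rewrite H by lia.
Qed.

Lemma prodR_pos n f : (forall i, (i < n)%nat -> 0 < f i) -> 0 < prodR n f.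
Proof.
  induction n as [|n IH]; intros H; [unfold prodR; simpl; lra|].
  rewrite prodR_S. apply Rmult_lt_0_compat; [apply IH; intros|]; apply H; lia.
Qed.

Lemma prodR_le n f g : (forall i, (i < n)%nat -> 0 <= f i <= g i) -> 0 <= prodR n f <= prodR n g.
Proof.
  induction n as [|n IH]; intros H; [unfold prodR; simpl; lra|].
  rewrite !prodR_S.
  destruct IH as [A B]; [intros; apply H; lia|]. destruct (H n) as [C D]; [lia|].
  split; [nra|]. now apply Rmult_le_compat.
Qed.

Lemma prodR_mult n f g : prodR n (fun i => f i * g i) = prodR n f * prodR n g.
Proof.
  induction n as [|n IH]; [unfold prodR; simpl; ring|]. rewrite !prodR_S, IH. ring.
Qed.

Lemma prodR_Rabs n f : Rabs (prodR n f) = prodR n (fun i => Rabs (f i)).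
Proof.
  induction n as [|n IH]; [unfold prodR; simpl; apply Rabs_R1|].
  now rewrite !prodR_S, Rabs_mult, IH.
Qed.

Lemma sumk_S n k : sumk (S n) k = (sumk n k + k n)%nat.
Proof.
  unfold sumk. rewrite seq_S, map_app, fold_right_app. simpl.
  induction (map k (seq 0 n)) as [|a l IH]; simpl; lia.
Qed.

Lemma INR_sumk n k : INR (sumk n k) = rsum n (fun i => INR (k i)).
Proof. induction n as [|n IH]; [easy|]. rewrite sumk_S, plus_INR, IH. easy. Qed.

Lemma sumk_term_le n k i : (i < n)%nat -> (k i <= sumk n k)%nat.
Proof.
  induction n as [|n IH]; intros Hi; [lia|]. rewrite sumk_S.
  destruct (Nat.eq_dec i n) as [->|Hn]; [lia|]. assert (k i <= sumk n k)%nat by (apply IH; lia). lia.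
Qed.

(** * Real powers with the convention 0^0 = 1 *)

Lemma rpow_pos a s : 0 < a -> rpow a s = Rpower a s.
Proof. intros H. unfold rpow. destruct (Req_EM_T a 0); [lra|easy]. Qed.

Lemma rpow_0_l s : s <> 0 -> rpow 0 s = 0.
Proof. intros H. unfold rpow. destruct (Req_EM_T 0 0), (Req_EM_T s 0); easy. Qed.

Lemma rpow_0_r a : rpow a 0 = 1.
Proof.
  unfold rpow. destruct (Req_EM_T a 0), (Req_EM_T 0 0); try easy.
  unfold Rpower. rewrite Rmult_0_l. apply exp_0.
Qed.

Lemma rpow_gt0 a s : 0 < a -> 0 < rpow a s.
Proof. intros H. rewrite rpow_pos by easy. apply exp_pos. Qed.

Lemma rpow_nonneg a s : 0 <= rpow a s.
Proof.
  unfold rpow. destruct (Req_EM_T a 0); [destruct (Req_EM_T s 0); lra|].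
  left; apply exp_pos.
Qed.

Lemma rpow_1_l s : rpow 1 s = 1.
Proof. rewrite rpow_pos by lra. unfold Rpower. rewrite ln_1, Rmult_0_r. apply exp_0. Qed.

Lemma rpow_le_l a b s : 0 < s -> 0 <= a <= b -> rpow a s <= rpow b s.
Proof.
  intros Hs [Ha Hb]. destruct (Req_dec a 0) as [->|Ha'].
  - rewrite rpow_0_l by lra. apply rpow_nonneg.
  - rewrite !rpow_pos by lra. apply Rle_Rpower_l; lra.
Qed.

Lemma rpow_lt_l a b s : 0 < s -> 0 <= a < b -> rpow a s < rpow b s.
Proof.
  intros Hs [Ha Hb]. destruct (Req_dec a 0) as [->|Ha'].
  - rewrite rpow_0_l by lra. apply rpow_gt0; lra.
  - rewrite !rpow_pos by lra. apply exp_increasing, Rmult_lt_compat_l; [lra|].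
    apply ln_increasing; lra.
Qed.

Lemma rpow_le_inv a b s : 0 < s -> 0 <= a -> 0 <= b -> rpow a s <= rpow b s -> a <= b.
Proof.
  intros Hs Ha Hb H. destruct (Rle_lt_dec a b) as [|Hlt]; [easy|].
  assert (rpow b s < rpow a s) by (apply rpow_lt_l; lra). lra.
Qed.

Lemma rpow_mult_l a b s : 0 <= a -> 0 <= b -> rpow (a * b) s = rpow a s * rpow b s.
Proof.
  intros Ha Hb. destruct (Req_dec s 0) as [->|Hs]; [rewrite !rpow_0_r; ring|].
  destruct (Req_dec a 0) as [->|Ha']; [rewrite Rmult_0_l, rpow_0_l by easy; ring|].
  destruct (Req_dec b 0) as [->|Hb']; [rewrite Rmult_0_r, rpow_0_l by easy; ring|].
  assert (0 < a * b) by (apply Rmult_lt_0_compat; lra).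
  rewrite !rpow_pos by lra. symmetry. apply Rpower_mult_distr; lra.
Qed.

Lemma rpow_plus a s t : 0 < a -> rpow a (s + t) = rpow a s * rpow a t.
Proof. intros Ha. rewrite !rpow_pos by easy. apply Rpower_plus. Qed.

Lemma rpow_rpow a s t : 0 <= a -> s <> 0 -> rpow (rpow a s) t = rpow a (s * t).
Proof.
  intros Ha Hs. destruct (Req_dec t 0) as [->|Ht]; [now rewrite Rmult_0_r, !rpow_0_r|].
  destruct (Req_dec a 0) as [->|Ha'].
  - assert (s * t <> 0) by (apply Rmult_integral_contrapositive; easy).
    now rewrite !rpow_0_l.
  - assert (0 < rpow a s) by (apply rpow_gt0; lra).
    rewrite (rpow_pos (rpow a s)), !rpow_pos by lra. apply Rpower_mult.
Qed.

Lemma rpow_INR a n : 0 <= a -> rpow a (INR n) = a ^ n.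
Proof.
  intros Ha. destruct (Req_dec a 0) as [->|Ha'].
  - destruct n as [|n]; [apply rpow_0_r|]. rewrite rpow_0_l by (apply not_0_INR; lia).
    now rewrite pow_i by lia.
  - rewrite rpow_pos by lra. apply Rpower_pow; lra.
Qed.

Lemma rpow_1_r a : 0 <= a -> rpow a 1 = a.
Proof. intros Ha. change 1 with (INR 1). rewrite rpow_INR by easy. ring. Qed.

(** Turns the half-integer exponents of the bounds into integer powers of a square root, which suit
    an induction on m. *)
Lemma rpow_half a m : 0 <= a -> rpow a (INR m / 2) = sqrt a ^ m.
Proof.
  intros Ha. rewrite <- rpow_INR by apply sqrt_pos.
  destruct (Req_dec a 0) as [->|Ha'].
  - rewrite sqrt_0. destruct m as [|m].
    + simpl. unfold Rdiv. now rewrite Rmult_0_l.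
    + pose proof (not_0_INR (S m) ltac:(lia)). rewrite !rpow_0_l; lra.
  - assert (0 < sqrt a) by (apply sqrt_lt_R0; lra).
    rewrite !rpow_pos by lra. rewrite <- (Rpower_sqrt a) by lra.
    rewrite Rpower_mult. f_equal. lra.
Qed.

Lemma ln_le_sub1 x : 0 < x -> ln x <= x - 1.
Proof.
  intros Hx. pose proof (exp_ineq1_le (ln x)) as H. rewrite exp_ln in H by easy. lra.
Qed.

(** * The Gamma function as the limit of Gauss' sequence *)

(** The inequality ln u <= u - 1 at u = y/(y+1). *)
Lemma inv_le_ln_diff y : 0 < y -> / (y + 1) <= ln (y + 1) - ln y.
Proof.
  intros Hy. assert (0 < y / (y + 1)) by (apply Rdiv_lt_0_compat; lra).
  pose proof (ln_le_sub1 _ H) as H1.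
  unfold Rdiv in H1 at 1. rewrite ln_mult, ln_Rinv in H1 by (try apply Rinv_0_lt_compat; lra).
  replace (y / (y + 1) - 1) with (- / (y + 1)) in H1 by (field; lra). lra.
Qed.

(** Divided by (y+1) y^d this reads 1 + d/(y+1) <= (1 + 1/y)^d, which follows from ln(1 + 1/y) >=
    1/(y+1). It is the single step behind both the comparison of rising products and the
    monotonicity of Gauss' sequence. *)
Lemma shifted_factor_le y d : 0 < y -> 0 <= d ->
  (y + 1 + d) * Rpower y d <= (y + 1) * Rpower (y + 1) d.
Proof.
  intros Hy Hd.
  assert (H : 1 + d / (y + 1) <= exp (d * (ln (y + 1) - ln y))).
  { apply Rle_trans with (exp (d / (y + 1))); [apply exp_ineq1_le|].
    assert (Hle : d / (y + 1) <= d * (ln (y + 1) - ln y)).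
    { apply Rmult_le_compat_l; [easy|]. now apply inv_le_ln_diff. }
    destruct Hle as [Hlt| ->]; [left; now apply exp_increasing|right; easy]. }
  unfold Rpower.
  replace (exp (d * ln (y + 1))) with (exp (d * (ln (y + 1) - ln y)) * exp (d * ln y))
    by (rewrite <- exp_plus; f_equal; ring).
  replace (y + 1 + d) with ((y + 1) * (1 + d / (y + 1))) by (field; lra).
  rewrite Rmult_assoc. apply Rmult_le_compat_l; [lra|].
  apply Rmult_le_compat_r; [left; apply exp_pos|easy].
Qed.

Lemma rising_pos s N : 0 < s -> 0 < prodR N (fun j => s + INR j).
Proof. intros Hs. apply prodR_pos. intros i _. pose proof (pos_INR i). lra. Qed.

(** Finite form of s Gamma(s) s^d <= (s+d) Gamma(s+d). Both sides agree at N = 0, and each further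
    factor is [shifted_factor_le] at y = s + N. *)
Lemma rising_shift_le s d N : 0 < s -> 0 <= d ->
  prodR (S N) (fun j => s + d + INR j) * (s * Rpower s d)
  <= (s + d) * Rpower (s + INR N) d * prodR (S N) (fun j => s + INR j).
Proof.
  intros Hs Hd. induction N as [|N IH].
  - unfold prodR; simpl. rewrite !Rplus_0_r. right; ring.
  - rewrite (prodR_S (S N)), (prodR_S (S N) (fun j => s + INR j)).
    pose proof (pos_INR N) as HN.
    assert (H : (s + INR N + 1 + d) * Rpower (s + INR N) d
                <= (s + INR N + 1) * Rpower (s + INR N + 1) d)
      by (apply shifted_factor_le; lra).
    pose proof (rising_pos s (S N) Hs) as HP.
    rewrite S_INR. replace (s + (INR N + 1)) with (s + INR N + 1) by ring.
    apply Rle_trans with ((s + d + (INR N + 1)) *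
       ((s + d) * Rpower (s + INR N) d * prodR (S N) (fun j => s + INR j))).
    + replace (prodR (S N) (fun j => s + d + INR j) * (s + d + (INR N + 1)) * (s * Rpower s d))
        with ((s + d + (INR N + 1)) * (prodR (S N) (fun j => s + d + INR j) * (s * Rpower s d)))
        by ring.
      apply Rmult_le_compat_l; [lra|easy].
    + replace ((s + d + (INR N + 1)) *
       ((s + d) * Rpower (s + INR N) d * prodR (S N) (fun j => s + INR j))) with
       ((s + d) * prodR (S N) (fun j => s + INR j) *
          ((s + INR N + 1 + d) * Rpower (s + INR N) d)) by ring.
      replace ((s + d) * Rpower (s + INR N + 1) d *
        (prodR (S N) (fun j => s + INR j) * (s + INR N + 1))) with
       ((s + d) * prodR (S N) (fun j => s + INR j) *
          ((s + INR N + 1) * Rpower (s + INR N + 1) d)) by ring.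
      apply Rmult_le_compat_l; [|easy]. apply Rmult_le_pos; lra.
Qed.

Lemma gauss_seq_pos s N : 0 < s -> 0 < gauss_seq s N.
Proof.
  intros Hs. unfold gauss_seq. apply Rdiv_lt_0_compat; [|now apply rising_pos].
  apply Rmult_lt_0_compat; [apply exp_pos|apply INR_fact_lt_0].
Qed.

(** With T = N + 1, the factor (T/(T+s))^d exchanges the (s+T)^d of the product estimate for the T^d
    of Gauss' sequence; it tends to 1. *)
Lemma gauss_seq_shift_le s d N : 0 < s -> 0 <= d ->
  gauss_seq s (S N) * (s * Rpower s d) * Rpower (INR (S N) / (INR (S N) + s)) d
  <= gauss_seq (s + d) (S N) * (s + d).
Proof.
  intros Hs Hd. assert (HN : 0 < INR (S N)) by (apply lt_0_INR; lia).
  unfold gauss_seq.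
  pose proof (rising_shift_le s d (S N) Hs Hd) as H.
  pose proof (rising_pos s (S (S N)) Hs) as HP.
  pose proof (rising_pos (s + d) (S (S N)) ltac:(lra)) as HQ.
  set (P := prodR (S (S N)) (fun j => s + INR j)) in *.
  set (Q := prodR (S (S N)) (fun j => s + d + INR j)) in *.
  pose proof (INR_fact_lt_0 (S N)) as Hf.
  assert (E : Rpower (INR (S N) / (INR (S N) + s)) d * Rpower (s + INR (S N)) d
              = Rpower (INR (S N)) d).
  { rewrite Rpower_mult_distr; [f_equal; field; lra| |lra]. apply Rdiv_lt_0_compat; lra. }
  set (w := Rpower (INR (S N) / (INR (S N) + s)) d) in *.
  assert (Hw : 0 < w) by apply exp_pos.
  rewrite Rpower_plus, <- E. set (T := INR (S N)) in *. set (f := INR (fact (S N))) in *.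
  assert (HT : 0 < Rpower T s) by apply exp_pos.
  apply Rmult_le_reg_r with (P * Q); [now apply Rmult_lt_0_compat|].
  replace (Rpower T s * f / P * (s * Rpower s d) * w * (P * Q))
    with (Rpower T s * f * w * (Q * (s * Rpower s d))) by (field; lra).
  replace (Rpower T s * (w * Rpower (s + T) d) * f / Q * (s + d) * (P * Q))
    with (Rpower T s * f * w * ((s + d) * Rpower (s + T) d * P)) by (field; lra).
  apply Rmult_le_compat_l; [|easy].
  repeat apply Rmult_le_pos; lra.
Qed.

Lemma gauss_seq_succ s N : 0 < s ->
  gauss_seq (s + 1) (S N) = s * gauss_seq s (S N) * (INR (S N) / (INR (S N) + (s + 1))).
Proof.
  intros Hs. unfold gauss_seq.
  assert (HN : 0 < INR (S N)) by (apply lt_0_INR; lia).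
  (* The two rising products differ only in their end factors. *)
  assert (E : forall n, s * prodR n (fun j => s + 1 + INR j)
                   = prodR n (fun j => s + INR j) * (s + INR n)).
  { intros n. induction n as [|n IH]; [unfold prodR; simpl; ring|].
    rewrite !prodR_S, <- Rmult_assoc, IH, S_INR. ring. }
  specialize (E (S (S N))).
  pose proof (rising_pos s (S (S N)) Hs) as HP.
  pose proof (rising_pos (s + 1) (S (S N)) ltac:(lra)) as HQ.
  set (P := prodR (S (S N)) (fun j => s + INR j)) in *.
  set (Q := prodR (S (S N)) (fun j => s + 1 + INR j)) in *.
  rewrite (S_INR (S N)) in E.
  rewrite Rpower_plus, Rpower_1 by easy. set (T := INR (S N)) in *.
  replace Q with (P * (s + (T + 1)) / s).
  - field. repeat split; lra.
  - rewrite <- E. field. lra.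
Qed.

(** With denominators cleared this is [shifted_factor_le] at y = N + 1 and d = s. Growth starts at
    index 1: at index 0 the default [ln 0 = 0] yields the value 1/s, which exceeds the next term
    1/(s(s+1)). *)
Lemma gauss_seq_growing s : 0 < s -> Un_growing (fun N => gauss_seq s (S N)).
Proof.
  intros Hs N. unfold gauss_seq. rewrite (prodR_S (S (S N))).
  pose proof (rising_pos s (S (S N)) Hs) as HP.
  set (P := prodR (S (S N)) (fun j => s + INR j)) in *.
  rewrite (fact_simpl (S N)), mult_INR.
  set (f := INR (fact (S N))). pose proof (INR_fact_lt_0 (S N) : 0 < f) as Hf.
  rewrite (S_INR (S N)). assert (HT : 0 < INR (S N)) by (apply lt_0_INR; lia).
  set (T := INR (S N)) in *.
  assert (H : (s + (T + 1)) * Rpower T s <= (T + 1) * Rpower (T + 1) s)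
    by (rewrite <- (Rplus_comm (T + 1)); apply shifted_factor_le; lra).
  apply Rmult_le_reg_r with (P * (s + (T + 1))); [apply Rmult_lt_0_compat; lra|].
  replace (Rpower T s * f / P * (P * (s + (T + 1)))) with (f * ((s + (T + 1)) * Rpower T s))
    by (field; lra).
  replace (Rpower (T + 1) s * ((T + 1) * f) / (P * (s + (T + 1))) * (P * (s + (T + 1))))
    with (f * ((T + 1) * Rpower (T + 1) s)) by (field; lra).
  apply Rmult_le_compat_l; lra.
Qed.

Lemma gauss_seq_1_le N : gauss_seq 1 (S N) <= 1.
Proof.
  unfold gauss_seq.
  assert (E : forall n, prodR n (fun j => 1 + INR j) = INR (fact n)).
  { intros n. induction n as [|n IH]; [easy|].
    rewrite prodR_S, IH, fact_simpl, mult_INR, S_INR. ring. }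
  rewrite E. pose proof (INR_fact_lt_0 (S N)) as Hf.
  rewrite (fact_simpl (S N)), mult_INR, (S_INR (S N)).
  assert (HT : 0 < INR (S N)) by (apply lt_0_INR; lia).
  rewrite Rpower_1 by easy. set (T := INR (S N)) in *. set (f := INR (fact (S N))) in *.
  apply Rmult_le_reg_r with ((T + 1) * f); [apply Rmult_lt_0_compat; lra|].
  replace (T * f / ((T + 1) * f) * ((T + 1) * f)) with (T * f) by (field; lra). nra.
Qed.

Lemma gauss_seq_nat_bounded b : exists C, forall N, gauss_seq (INR (S b)) (S N) <= C.
Proof.
  induction b as [|b [C HC]]; [exists 1; intros; apply gauss_seq_1_le|].
  exists (INR (S b) * C). intros N. rewrite S_INR.
  assert (HN : 0 < INR (S N)) by (apply lt_0_INR; lia).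
  assert (Hb : 0 < INR (S b)) by (apply lt_0_INR; lia).
  rewrite gauss_seq_succ by easy.
  pose proof (gauss_seq_pos (INR (S b)) (S N) Hb).
  assert (INR (S N) / (INR (S N) + (INR (S b) + 1)) <= 1).
  { apply Rmult_le_reg_r with (INR (S N) + (INR (S b) + 1)); [lra|].
    unfold Rdiv. rewrite Rmult_assoc, Rinv_l; lra. }
  apply Rle_trans with (INR (S b) * gauss_seq (INR (S b)) (S N) * 1).
  - apply Rmult_le_compat_l; [apply Rmult_le_pos; lra|easy].
  - rewrite Rmult_1_r. apply Rmult_le_compat_l; [lra|apply HC].
Qed.

(** At positive integers a bound comes from the functional equation; the shift inequality carries it
    down from an integer above s to s itself. *)
Lemma gauss_seq_bounded s : 0 < s -> exists C, forall N, gauss_seq s (S N) <= C.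
Proof.
  intros Hs. destruct (INR_unbounded s) as [b Hb].
  destruct (gauss_seq_nat_bounded b) as [C HC].
  set (d := INR (S b) - s). assert (Hd : 0 <= d) by (unfold d; rewrite S_INR; lra).
  exists (C * INR (S b) * Rpower (1 + s) d / (s * Rpower s d)). intros N.
  assert (HN : 1 <= INR (S N)) by (rewrite S_INR; pose proof (pos_INR N); lra).
  pose proof (gauss_seq_shift_le s d N Hs Hd) as H.
  replace (s + d) with (INR (S b)) in H by (unfold d; ring).
  assert (Hsd : 0 < Rpower s d) by apply exp_pos.
  (* T/(T+s) is smallest at T = 1, so the correction factor has a positive lower bound independent
     of N. *)
  assert (H1 : / Rpower (1 + s) d <= Rpower (INR (S N) / (INR (S N) + s)) d).
  { rewrite <- Rpower_Ropp. unfold Rpower at 1.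
    rewrite Ropp_mult_distr_l_reverse, Ropp_mult_distr_r, <- ln_Rinv by lra.
    change (Rpower (/ (1 + s)) d <= Rpower (INR (S N) / (INR (S N) + s)) d).
    apply Rle_Rpower_l; [easy|]. split; [apply Rinv_0_lt_compat; lra|].
    apply Rmult_le_reg_r with ((1 + s) * (INR (S N) + s)); [apply Rmult_lt_0_compat; lra|].
    replace (/ (1 + s) * ((1 + s) * (INR (S N) + s))) with (INR (S N) + s) by (field; lra).
    replace (INR (S N) / (INR (S N) + s) * ((1 + s) * (INR (S N) + s)))
      with (INR (S N) * (1 + s)) by (field; lra). nra. }
  assert (H1s : 0 < Rpower (1 + s) d) by apply exp_pos.
  pose proof (gauss_seq_pos s (S N) Hs) as Hg.
  assert (Hb' : 0 < INR (S b)) by (apply lt_0_INR; lia).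
  assert (H2 : gauss_seq s (S N) * (s * Rpower s d) * / Rpower (1 + s) d <= C * INR (S b)).
  { eapply Rle_trans; [|eapply Rle_trans; [exact H|]].
    - apply Rmult_le_compat_l; [|easy].
      apply Rmult_le_pos; [lra|]. apply Rmult_le_pos; lra.
    - apply Rmult_le_compat_r; [lra|apply HC]. }
  apply Rmult_le_reg_r with (s * Rpower s d * / Rpower (1 + s) d).
  { repeat apply Rmult_lt_0_compat; try lra. now apply Rinv_0_lt_compat. }
  replace (C * INR (S b) * Rpower (1 + s) d / (s * Rpower s d) * (s * Rpower s d * / Rpower (1 + s) d))
    with (C * INR (S b)) by (field; lra). lra.
Qed.

Lemma Gamma_cv s : 0 < s -> Un_cv (gauss_seq s) (Gamma s).
Proof.
  intros Hs. unfold Gamma. apply epsilon_spec.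
  destruct (Un_cv_crit (fun N => gauss_seq s (S N))) as [l Hl].
  - now apply gauss_seq_growing.
  - destruct (gauss_seq_bounded s Hs) as [C HC]. exists C. intros x [N ->]. apply HC.
  - exists l. apply CV_shift with 1%nat.
    intros eps Heps. destruct (Hl eps Heps) as [N0 H]. exists N0. intros N HN.
    replace (N + 1)%nat with (S N) by lia. now apply H.
Qed.

Lemma Gamma_cv_S s : 0 < s -> Un_cv (fun N => gauss_seq s (S N)) (Gamma s).
Proof.
  intros Hs eps Heps. destruct (Gamma_cv s Hs eps Heps) as [N0 H].
  exists N0. intros N HN. apply H. lia.
Qed.

(** Makes every term from index 1 on a numerical lower bound for [Gamma]. *)
Lemma gauss_seq_le_Gamma s N : 0 < s -> gauss_seq s (S N) <= Gamma s.
Proof.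
  intros Hs. apply (growing_ineq (fun N => gauss_seq s (S N))).
  - now apply gauss_seq_growing.
  - now apply Gamma_cv_S.
Qed.

Lemma Gamma_pos s : 0 < s -> 0 < Gamma s.
Proof.
  intros Hs. eapply Rlt_le_trans; [apply (gauss_seq_pos s 1 Hs)|now apply gauss_seq_le_Gamma].
Qed.

Lemma ratio_cv_1 c : 0 < c -> Un_cv (fun N => INR (S N) / (INR (S N) + c)) 1.
Proof.
  intros Hc eps Heps. destruct (INR_unbounded (c / eps)) as [N0 H0].
  exists N0. intros N HN. unfold Rdist.
  assert (INR N0 <= INR (S N)) by (apply le_INR; lia).
  assert (HT : 0 < INR (S N)) by (apply lt_0_INR; lia). set (T := INR (S N)) in *.
  replace (T / (T + c) - 1) with (- (c / (T + c))) by (field; lra).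
  rewrite Rabs_Ropp, Rabs_pos_eq by (left; apply Rdiv_lt_0_compat; lra).
  assert (c < eps * T).
  { replace c with (eps * (c / eps)) by (field; lra). apply Rmult_lt_compat_l; lra. }
  apply Rmult_lt_reg_r with (T + c); [lra|].
  replace (c / (T + c) * (T + c)) with c by (field; lra). nra.
Qed.

Lemma Gamma_succ s : 0 < s -> Gamma (s + 1) = s * Gamma s.
Proof.
  intros Hs. apply (UL_sequence (fun N => gauss_seq (s + 1) (S N))); [apply Gamma_cv_S; lra|].
  replace (s * Gamma s) with (s * Gamma s * 1) by ring.
  assert (H : Un_cv (fun N => s * gauss_seq s (S N) * (INR (S N) / (INR (S N) + (s + 1))))
                (s * Gamma s * 1)).
  { apply (CV_mult (fun N => s * gauss_seq s (S N))); [|apply ratio_cv_1; lra].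
    apply (CV_mult (fun _ => s)); [|now apply Gamma_cv_S].
    intros eps Heps. exists 0%nat. intros. unfold Rdist. rewrite Rminus_diag, Rabs_R0. easy. }
  intros eps Heps. destruct (H eps Heps) as [N0 HN]. exists N0. intros N HNN.
  rewrite gauss_seq_succ by easy. now apply HN.
Qed.

Lemma Gamma_growth s d : 0 < s -> 0 <= d ->
  Gamma s * (s * Rpower s d) <= Gamma (s + d) * (s + d).
Proof.
  intros Hs Hd. set (c := s * Rpower s d).
  apply (Rle_cv_lim
    (Un := fun N => gauss_seq s (S N) * c * Rpower (INR (S N) / (INR (S N) + s)) d)
    (Vn := fun N => gauss_seq (s + d) (S N) * (s + d))).
  - intros N. now apply gauss_seq_shift_le.
  - replace (Gamma s * c) with (Gamma s * c * Rpower 1 d)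
      by (unfold Rpower; rewrite ln_1, Rmult_0_r, exp_0; ring).
    apply (CV_mult (fun N => gauss_seq s (S N) * c)).
    + apply (CV_mult (fun N => gauss_seq s (S N)) (fun _ => c)); [now apply Gamma_cv_S|].
      intros eps Heps. exists 0%nat. intros. unfold Rdist. rewrite Rminus_diag, Rabs_R0. easy.
    + apply (continuity_seq (fun x => Rpower x d)); [|now apply ratio_cv_1].
      apply derivable_continuous_pt. eexists. apply derivable_pt_lim_power. lra.
  - apply (CV_mult (fun N => gauss_seq (s + d) (S N)) (fun _ => s + d)); [apply Gamma_cv_S; lra|].
    intros eps Heps. exists 0%nat. intros. unfold Rdist. rewrite Rminus_diag, Rabs_R0. easy.
Qed.

(** * Averages over signs and Khinchine's inequality *)

(** The expectation over q independent fair signs, encoded so that an induction on q conditions on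
    the first sign. *)
Fixpoint sign_mean (q : nat) (f : list R -> R) : R :=
  match q with
  | O => f nil
  | S q => (sign_mean q (fun e => f (1 :: e)) + sign_mean q (fun e => f (-1 :: e))) / 2
  end.

Definition signs (q : nat) (e : list R) : Prop :=
  length e = q /\ Forall (fun x => Rabs x = 1) e.

Lemma signs_cons q c e : Rabs c = 1 -> signs q e -> signs (S q) (c :: e).
Proof. intros Hc [H1 H2]. split; [simpl; congruence|now constructor]. Qed.

Lemma sign_mean_le q f g :
  (forall e, signs q e -> f e <= g e) -> sign_mean q f <= sign_mean q g.
Proof.
  revert f g. induction q as [|q IH]; intros f g H; simpl.
  - apply H. now split.
  - assert (sign_mean q (fun e => f (1 :: e)) <= sign_mean q (fun e => g (1 :: e))).
    { apply IH. intros e He. apply H, signs_cons; [apply Rabs_R1|easy]. }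
    assert (sign_mean q (fun e => f (-1 :: e)) <= sign_mean q (fun e => g (-1 :: e))).
    { apply IH. intros e He. apply H, signs_cons; [|easy]. rewrite Rabs_left; lra. }
    lra.
Qed.

Lemma sign_mean_ext q f g :
  (forall e, signs q e -> f e = g e) -> sign_mean q f = sign_mean q g.
Proof.
  intros H. apply Rle_antisym; apply sign_mean_le; intros e He; rewrite (H e He); lra.
Qed.

Lemma sign_mean_lin q al be f g :
  sign_mean q (fun e => al * f e + be * g e) = al * sign_mean q f + be * sign_mean q g.
Proof.
  revert f g. induction q as [|q IH]; intros f g; simpl; [easy|].
  rewrite (IH (fun e => f (1 :: e)) (fun e => g (1 :: e))).
  rewrite (IH (fun e => f (-1 :: e)) (fun e => g (-1 :: e))). lra.
Qed.

Lemma sign_mean_const q c : sign_mean q (fun _ => c) = c.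
Proof. induction q as [|q IH]; simpl; [easy|]. rewrite IH. lra. Qed.

Lemma sign_mean_scal q c f : sign_mean q (fun e => c * f e) = c * sign_mean q f.
Proof.
  pose proof (sign_mean_lin q c 0 f f) as H. rewrite Rmult_0_l, Rplus_0_r in H.
  rewrite <- H. apply sign_mean_ext. intros; ring.
Qed.

Lemma sign_mean_minus q f g : sign_mean q (fun e => f e - g e) = sign_mean q f - sign_mean q g.
Proof.
  pose proof (sign_mean_lin q 1 (-1) f g) as H.
  replace (sign_mean q f - sign_mean q g) with (1 * sign_mean q f + -1 * sign_mean q g) by ring.
  rewrite <- H. apply sign_mean_ext. intros; ring.
Qed.

Lemma sign_mean_plus q f g : sign_mean q (fun e => f e + g e) = sign_mean q f + sign_mean q g.
Proof.
  pose proof (sign_mean_lin q 1 1 f g) as H.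
  replace (sign_mean q f + sign_mean q g) with (1 * sign_mean q f + 1 * sign_mean q g) by ring.
  rewrite <- H. apply sign_mean_ext. intros; ring.
Qed.

Lemma sign_mean_rsum q n f :
  sign_mean q (fun e => rsum n (f e)) = rsum n (fun i => sign_mean q (fun e => f e i)).
Proof.
  induction n as [|n IH]; simpl; [apply sign_mean_const|].
  rewrite (sign_mean_plus q (fun e => rsum n (f e)) (fun e => f e n)). now rewrite IH.
Qed.

Lemma sign_mean_Rabs q f : Rabs (sign_mean q f) <= sign_mean q (fun e => Rabs (f e)).
Proof.
  apply Rabs_le. split.
  - replace (- sign_mean q (fun e => Rabs (f e)))
      with (sign_mean q (fun e => -1 * Rabs (f e))) by (rewrite sign_mean_scal; ring).
    apply sign_mean_le. intros e _. pose proof (Rle_abs (- f e)) as H.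
    rewrite Rabs_Ropp in H. lra.
  - apply sign_mean_le. intros e _. apply Rle_abs.
Qed.

Fixpoint dot (e c : list R) : R :=
  match e, c with x :: e, y :: c => x * y + dot e c | _, _ => 0 end.

Fixpoint sqnorm (c : list R) : R :=
  match c with nil => 0 | y :: c => y * y + sqnorm c end.

Lemma sqnorm_nonneg c : 0 <= sqnorm c.
Proof. induction c as [|y c IH]; simpl; nra. Qed.

(** Trapezoid rule: a^(m+1) - b^(m+1) is the integral of (m+1) t^m from b to a, and the chord lies
    above the graph of the convex function t^m. *)
Lemma pow_diff_trapezoid m a b : 0 <= b <= a ->
  2 * (a ^ S m - b ^ S m) <= INR (S m) * (a - b) * (a ^ m + b ^ m).
Proof.
  intros [Hb Hab]. induction m as [|m IH]; [simpl; lra|].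
  assert (Hm : b ^ S m <= a ^ S m) by (apply pow_incr; lra).
  assert (Hp : 0 <= a ^ m - b ^ m) by (pose proof (pow_incr b a m ltac:(lra)); lra).
  rewrite S_INR.
  set (P := a ^ m) in *. set (Q := b ^ m) in *.
  replace (a ^ S (S m)) with (a * (a * P)) by (unfold P; simpl; ring).
  replace (b ^ S (S m)) with (b * (b * Q)) by (unfold Q; simpl; ring).
  change (a ^ S m) with (a * P) in *. change (b ^ S m) with (b * Q) in *.
  assert (HT : 0 <= INR (S m)) by apply pos_INR. set (T := INR (S m)) in *.
  (* This is (a - b)(P - Q) >= 0. The induction step then rests on 2(a^2 P - b^2 Q) = (a + b)(aP -
     bQ) + (a - b)(aP + bQ). *)
  assert (H1 : (a + b) * (P + Q) <= 2 * (a * P + b * Q)) by nra.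
  assert (H2 : (a + b) * (2 * (a * P - b * Q)) <= (a + b) * (T * (a - b) * (P + Q)))
    by (apply Rmult_le_compat_l; lra).
  assert (H3 : T * (a - b) * ((a + b) * (P + Q)) <= T * (a - b) * (2 * (a * P + b * Q)))
    by (apply Rmult_le_compat_l; [apply Rmult_le_pos; lra|easy]).
  nra.
Qed.

(** The same rule for x|x|^m, whose derivative is (m+1)|x|^m. If b < 0 < a, the bound m + 1 >= 2
    suffices, since the cross terms a|b|^m and |b|a^m are nonnegative. *)
Lemma signed_pow_diff_trapezoid m a b : (1 <= m)%nat -> b <= a ->
  2 * (a * Rabs a ^ m - b * Rabs b ^ m) <= INR (S m) * (a - b) * (Rabs a ^ m + Rabs b ^ m).
Proof.
  intros Hm Hab.
  destruct (Rle_dec 0 b) as [Hb|Hb]; [|destruct (Rle_dec a 0) as [Ha|Ha]].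
  - rewrite !Rabs_pos_eq by lra. apply (pow_diff_trapezoid m a b). lra.
  - pose proof (pow_diff_trapezoid m (- b) (- a) ltac:(lra)) as H. simpl pow in H.
    rewrite !Rabs_left1 by lra.
    replace (- b - - a) with (a - b) in H by ring. lra.
  - assert (HS : 2 <= INR (S m)) by (change 2 with (INR 2); apply le_INR; lia).
    rewrite (Rabs_pos_eq a), (Rabs_left b) by lra.
    pose proof (pow_le a m ltac:(lra)) as HP. pose proof (pow_le (- b) m ltac:(lra)) as HQ.
    set (P := a ^ m) in *. set (Q := (- b) ^ m) in *.
    assert (H0 : 0 <= (a - b) * (P + Q)) by (apply Rmult_le_pos; lra).
    assert (H1 : 2 * ((a - b) * (P + Q)) <= INR (S m) * ((a - b) * (P + Q)))
      by (apply Rmult_le_compat_r; lra).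
    assert (0 <= a * Q) by (apply Rmult_le_pos; lra).
    assert (0 <= (- b) * P) by (apply Rmult_le_pos; lra). lra.
Qed.

(** The contribution of one sign: the interval between t - c and t + c has length 2|c|, and its ends
    exchange roles when c < 0. *)
Lemma sign_pair_le m t c : (1 <= m)%nat ->
  c * ((t + c) * Rabs (t + c) ^ m - (t - c) * Rabs (t - c) ^ m)
  <= INR (S m) * (c * c) * (Rabs (t + c) ^ m + Rabs (t - c) ^ m).
Proof.
  intros Hm. destruct (Rle_dec 0 c) as [Hc|Hc].
  - pose proof (signed_pow_diff_trapezoid m (t + c) (t - c) Hm ltac:(lra)) as H.
    replace (t + c - (t - c)) with (2 * c) in H by ring.
    apply (Rmult_le_compat_l c) in H; lra.
  - pose proof (signed_pow_diff_trapezoid m (t - c) (t + c) Hm ltac:(lra)) as H.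
    replace (t - c - (t + c)) with (2 * (- c)) in H by ring.
    apply (Rmult_le_compat_l (- c)) in H; lra.
Qed.

(* Integration by parts over signs: E[s g(t+s)] = sum_j c_j E[e_j g(t+s)], and averaging over e_j
   turns each term into a difference quotient of g. *)
Lemma sign_mean_by_parts m c t : (1 <= m)%nat ->
  sign_mean (length c) (fun e => dot e c * ((t + dot e c) * Rabs (t + dot e c) ^ m))
  <= INR (S m) * sqnorm c * sign_mean (length c) (fun e => Rabs (t + dot e c) ^ m).
Proof.
  intros Hm. revert t. induction c as [|y c IH]; intros t; simpl sign_mean; simpl dot; simpl sqnorm.
  { simpl. lra. }
  set (g := fun x => x * Rabs x ^ m). set (q := length c).
  (* The shift absorbs the first sign: [H1] and [H2] treat the remaining signs at t + y and t - y,
     and [H3] treats the first sign itself. *)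
  pose proof (IH (t + y)) as H1. pose proof (IH (t - y)) as H2. fold q in H1, H2.
  assert (H3 : sign_mean q (fun e => y * (g (t + dot e c + y) - g (t + dot e c - y)))
    <= sign_mean q (fun e => INR (S m) * (y * y) *
          (Rabs (t + y + dot e c) ^ m + Rabs (t - y + dot e c) ^ m))).
  { apply sign_mean_le. intros e _. unfold g.
    replace (t + y + dot e c) with (t + dot e c + y) by ring.
    replace (t - y + dot e c) with (t + dot e c - y) by ring. now apply sign_pair_le. }
  rewrite (sign_mean_scal q (INR (S m) * (y * y))), (sign_mean_plus q (fun e => Rabs (t + y + dot e c) ^ m)
    (fun e => Rabs (t - y + dot e c) ^ m)) in H3.
  rewrite (sign_mean_ext q (fun e => Rabs (t + (1 * y + dot e c)) ^ m)
             (fun e => Rabs (t + y + dot e c) ^ m))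
    by (intros; do 2 f_equal; ring).
  rewrite (sign_mean_ext q (fun e => Rabs (t + (-1 * y + dot e c)) ^ m)
             (fun e => Rabs (t - y + dot e c) ^ m))
    by (intros; do 2 f_equal; ring).
  rewrite (sign_mean_ext q
    (fun e => (1 * y + dot e c) * ((t + (1 * y + dot e c)) * Rabs (t + (1 * y + dot e c)) ^ m))
    (fun e => y * g (t + dot e c + y) + dot e c * ((t + y + dot e c) * Rabs (t + y + dot e c) ^ m))).
  2:{ intros e _. unfold g. replace (t + (1 * y + dot e c)) with (t + dot e c + y) by ring.
      replace (t + y + dot e c) with (t + dot e c + y) by ring. ring. }
  rewrite (sign_mean_ext q
    (fun e => (-1 * y + dot e c) * ((t + (-1 * y + dot e c)) * Rabs (t + (-1 * y + dot e c)) ^ m))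
    (fun e => dot e c * ((t - y + dot e c) * Rabs (t - y + dot e c) ^ m) - y * g (t + dot e c - y))).
  2:{ intros e _. unfold g. replace (t + (-1 * y + dot e c)) with (t + dot e c - y) by ring.
      replace (t - y + dot e c) with (t + dot e c - y) by ring. ring. }
  rewrite (sign_mean_plus q (fun e => y * g (t + dot e c + y))
      (fun e => dot e c * ((t + y + dot e c) * Rabs (t + y + dot e c) ^ m))),
    (sign_mean_minus q (fun e => dot e c * ((t - y + dot e c) * Rabs (t - y + dot e c) ^ m))
      (fun e => y * g (t + dot e c - y))).
  rewrite (sign_mean_ext q _ (fun e => y * g (t + dot e c + y) - y * g (t + dot e c - y))) in H3
    by (intros; ring).
  rewrite (sign_mean_minus q (fun e => y * g (t + dot e c + y))
    (fun e => y * g (t + dot e c - y))) in H3.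
  lra.
Qed.

(** The case t = 0 of the integration by parts, where s (s |s|^m) = |s|^(m+2). *)
Lemma moment_step m c : (1 <= m)%nat ->
  sign_mean (length c) (fun e => Rabs (dot e c) ^ S (S m))
  <= INR (S m) * sqnorm c * sign_mean (length c) (fun e => Rabs (dot e c) ^ m).
Proof.
  intros Hm. pose proof (sign_mean_by_parts m c 0 Hm) as H.
  rewrite (sign_mean_ext _ (fun e => Rabs (0 + dot e c) ^ m) (fun e => Rabs (dot e c) ^ m)) in H
    by (intros; now rewrite Rplus_0_l).
  rewrite (sign_mean_ext _ _ (fun e => Rabs (dot e c) ^ S (S m))) in H; [easy|].
  intros e _. rewrite Rplus_0_l. simpl.
  rewrite <- (Rmult_assoc (dot e c)), <- (Rmult_assoc (Rabs (dot e c))). f_equal.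
  rewrite <- Rabs_mult. rewrite Rabs_pos_eq; [easy|]. apply Rle_0_sqr.
Qed.

Lemma second_moment c t :
  sign_mean (length c) (fun e => (t + dot e c) ^ 2) = t ^ 2 + sqnorm c.
Proof.
  revert t. induction c as [|y c IH]; intros t; simpl sign_mean; simpl dot; simpl sqnorm.
  { simpl. ring. }
  rewrite (sign_mean_ext _ (fun e => (t + (1 * y + dot e c)) ^ 2) (fun e => (t + y + dot e c) ^ 2))
    by (intros; f_equal; ring).
  rewrite (sign_mean_ext _ (fun e => (t + (-1 * y + dot e c)) ^ 2) (fun e => (t - y + dot e c) ^ 2))
    by (intros; f_equal; ring).
  rewrite !IH. field.
Qed.

Lemma abs_moment_2 c :
  sign_mean (length c) (fun e => Rabs (dot e c) ^ 2) = sqnorm c.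
Proof.
  rewrite (sign_mean_ext _ _ (fun e => (0 + dot e c) ^ 2)).
  - rewrite second_moment. ring.
  - intros. now rewrite pow2_abs, Rplus_0_l.
Qed.

(** Cauchy-Schwarz in the form E(|s| - M)^2 >= 0 with M = E|s|. *)
Lemma abs_moment_1 c :
  sign_mean (length c) (fun e => Rabs (dot e c) ^ 1) <= sqrt (sqnorm c).
Proof.
  set (M := sign_mean (length c) (fun e => Rabs (dot e c) ^ 1)).
  assert (HM : 0 <= M).
  { rewrite <- (sign_mean_const (length c) 0). apply sign_mean_le. intros.
    apply pow_le, Rabs_pos. }
  rewrite <- (sqrt_square M HM). apply sqrt_le_1_alt.
  assert (H : 0 <= sign_mean (length c)
     (fun e => 1 * (Rabs (dot e c) ^ 2 + (-2 * M) * Rabs (dot e c) ^ 1) + 1 * (M * M))).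
  { rewrite <- (sign_mean_const (length c) 0). apply sign_mean_le. intros e _.
    pose proof (Rle_0_sqr (Rabs (dot e c) - M)) as H. unfold Rsqr in H. simpl. lra. }
  rewrite (sign_mean_lin _ 1 1 _ (fun _ => M * M)), sign_mean_const,
    (sign_mean_plus _ (fun e => Rabs (dot e c) ^ 2)), sign_mean_scal, abs_moment_2 in H.
  fold M in H. lra.
Qed.

Definition khinchine_const (m : nat) : R :=
  INR m * rpow 2 (INR m / 2) * Gamma (INR m / 2).

(** The factor m/2 from Gamma(m/2 + 1) and the extra factor 2 from the power together rebuild the
    leading m of [khinchine_const m]. *)
Lemma khinchine_const_SS m : (1 <= m)%nat ->
  khinchine_const (S (S m)) = INR (S (S m)) * khinchine_const m.
Proof.
  intros Hm. assert (0 < INR m) by (apply lt_0_INR; lia).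
  unfold khinchine_const. replace (INR (S (S m)) / 2) with (INR m / 2 + 1) by (rewrite !S_INR; lra).
  rewrite Gamma_succ, rpow_plus, rpow_1_r by lra. field.
Qed.

Lemma khinchine_const_1 : 1 <= khinchine_const 1.
Proof.
  unfold khinchine_const. rewrite rpow_half by lra. rewrite pow_1. simpl INR.
  (* Index 1 of Gauss' sequence gives Gamma(1/2) >= 1/((1/2)(3/2)) = 4/3. *)
  pose proof (gauss_seq_le_Gamma (1 / 2) 0 ltac:(lra)) as H.
  unfold gauss_seq, prodR in H. simpl in H. unfold Rpower in H. rewrite ln_1, Rmult_0_r, exp_0 in H.
  assert (4 / 3 <= Gamma (1 / 2)) by lra.
  assert (1 <= sqrt 2) by (rewrite <- sqrt_1 at 1; apply sqrt_le_1_alt; lra). nra.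
Qed.

Lemma khinchine_const_2 : 1 <= khinchine_const 2.
Proof.
  unfold khinchine_const. rewrite rpow_half by lra.
  rewrite pow2_sqrt by lra. simpl INR. replace ((1 + 1) / 2) with 1 by lra.
  (* Here index 1 gives Gamma(1) >= 1/2, so the constant is at least 2. *)
  pose proof (gauss_seq_le_Gamma 1 0 ltac:(lra)) as H.
  unfold gauss_seq, prodR in H. simpl in H. unfold Rpower in H. rewrite ln_1, Rmult_0_r, exp_0 in H.
  lra.
Qed.

Lemma pair_induction (P : nat -> Prop) :
  P 1%nat -> P 2%nat -> (forall m, (1 <= m)%nat -> P m -> P (S (S m))) ->
  forall m, (1 <= m)%nat -> P m.
Proof.
  intros H1 H2 HS. enough (H : forall m, P (S m) /\ P (S (S m))).
  { intros [|m] Hm; [lia|]. apply H. }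
  induction m as [|m [A B]]; [easy|]. split; [easy|]. apply HS; [lia|easy].
Qed.

Lemma khinchine_const_ge_1 m : (1 <= m)%nat -> 1 <= khinchine_const m.
Proof.
  revert m. apply pair_induction; [apply khinchine_const_1|apply khinchine_const_2|].
  intros m Hm IH. rewrite khinchine_const_SS by easy.
  assert (1 <= INR (S (S m))) by (apply (le_INR 1); lia). nra.
Qed.

(** The two recursions run in parallel: moments gain a factor m + 1, the constant gains m + 2. The
    starting points are Cauchy-Schwarz at m = 1 and the variance at m = 2. *)
Lemma khinchine m c : (1 <= m)%nat ->
  sign_mean (length c) (fun e => Rabs (dot e c) ^ m) <= khinchine_const m * sqrt (sqnorm c) ^ m.
Proof.
  revert m. pose proof (sqrt_pos (sqnorm c)) as Hs. pose proof (sqnorm_nonneg c) as Hn.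
  apply pair_induction.
  - pose proof (abs_moment_1 c). pose proof khinchine_const_1. rewrite pow_1. nra.
  - rewrite abs_moment_2, pow2_sqrt by easy. pose proof khinchine_const_2. nra.
  - intros m Hm IH. eapply Rle_trans; [now apply moment_step|].
    pose proof (khinchine_const_ge_1 m Hm) as HK. rewrite khinchine_const_SS by easy.
    simpl pow. rewrite <- (Rmult_assoc (sqrt (sqnorm c))), sqrt_sqrt by easy.
    pose proof (pow_le (sqrt (sqnorm c)) m Hs) as Hp.
    assert (HT : 0 <= INR (S m)) by apply pos_INR. rewrite (S_INR (S m)).
    assert (0 <= INR (S m) * sqnorm c) by now apply Rmult_le_pos.
    set (Z := khinchine_const m * sqrt (sqnorm c) ^ m) in *.
    assert (HZ : 0 <= Z) by (apply Rmult_le_pos; lra).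
    apply Rle_trans with (INR (S m) * sqnorm c * Z); [now apply Rmult_le_compat_l|].
    replace ((INR (S m) + 1) * khinchine_const m * (sqnorm c * sqrt (sqnorm c) ^ m))
      with ((INR (S m) + 1) * (sqnorm c * Z)) by (unfold Z; ring).
    assert (0 <= sqnorm c * Z) by now apply Rmult_le_pos. nra.
Qed.

(* With d = (r-m)/2, [Gamma_growth] leaves the factor (m/2)^d (2m)^d = m^(2d) >= 1. *)
Lemma khinchine_const_growth m r : (1 <= m)%nat -> INR m <= r ->
  khinchine_const m * sqrt (INR m) ^ m
  <= r * rpow 2 (r / 2) * Gamma (r / 2) * rpow (INR m) (r / 2).
Proof.
  intros Hm Hr. assert (HM : 1 <= INR m) by (apply (le_INR 1); lia).
  rewrite <- rpow_half by lra. unfold khinchine_const.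
  set (d := (r - INR m) / 2). set (M := INR m) in *.
  pose proof (Gamma_growth (M / 2) d ltac:(lra) ltac:(unfold d; lra)) as H.
  replace (r / 2) with (M / 2 + d) by (unfold d; lra).
  replace r with (2 * (M / 2 + d)) at 1 by (unfold d; lra).
  rewrite !rpow_plus by lra. rewrite !rpow_pos in * by lra.
  assert (HA : 0 < Rpower 2 (M / 2)) by apply exp_pos.
  assert (HB : 0 < Rpower M (M / 2)) by apply exp_pos.
  assert (HC : 0 < Rpower 2 d * Rpower M d) by (apply Rmult_lt_0_compat; apply exp_pos).
  assert (HD : 1 <= Rpower (M / 2) d * (Rpower 2 d * Rpower M d)).
  { rewrite !Rpower_mult_distr by lra.
    replace (M / 2 * (2 * M)) with (M * M) by field.
    rewrite <- (Rpower_O (M * M)) by nra.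
    destruct (Rle_lt_or_eq_dec 1 M HM) as [Hlt| <-].
    - apply Rle_Rpower; [nra|unfold d; lra].
    - unfold Rpower. rewrite Rmult_1_l, ln_1, !Rmult_0_r. lra. }
  pose proof (Gamma_pos (M / 2) ltac:(lra)) as HG.
  set (A := Rpower 2 (M / 2)) in *. set (B := Rpower M (M / 2)) in *.
  set (G := Gamma (M / 2)) in *. set (G' := Gamma (M / 2 + d)) in *.
  set (C := Rpower 2 d * Rpower M d) in *.
  replace (2 * (M / 2 + d) * (A * Rpower 2 d) * G' * (B * Rpower M d))
    with (2 * A * B * C * (G' * (M / 2 + d))) by (unfold C; ring).
  clearbody A B C G G'.
  assert (HP : 0 <= 2 * A * B * C) by (repeat apply Rmult_le_pos; lra).
  apply Rle_trans with (2 * A * B * C * (G * (M / 2 * Rpower (M / 2) d)));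
    [|now apply Rmult_le_compat_l].
  replace (2 * A * B * C * (G * (M / 2 * Rpower (M / 2) d)))
    with (M * A * G * B * (Rpower (M / 2) d * C)) by field.
  assert (0 <= M * A * G * B) by (repeat apply Rmult_le_pos; lra). nra.
Qed.

(** * Polarization *)

(** Multilinearity on all of [vec], without membership in l_p: forms pulled back to coefficients
    have it, because [comb] sends every coefficient vector into l_p. *)
Definition mlin (m : nat) (F : form) : Prop :=
  forall a b u v al be, (length a + S (length b))%nat = m ->
    F (a ++ vlin al u be v :: b) = al * F (a ++ u :: b) + be * F (a ++ v :: b).

Definition perm_invariant (m : nat) (F : form) : Prop :=
  forall l l', length l = m -> Permutation l l' -> F l = F l'.

Fixpoint lincomb (e : list R) (y : list vec) : vec :=
  match e, y with
  | c :: e, u :: y => vlin c u 1 (lincomb e y)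
  | _, _ => fun _ => 0
  end.

Lemma lincomb_coord e y i : lincomb e y i = dot e (map (fun u => u i) y).
Proof.
  revert y. induction e as [|c e IH]; intros [|u y]; simpl; try easy.
  unfold vlin. rewrite IH. ring.
Qed.

Definition lprod (e : list R) : R := fold_right Rmult 1 e.

Lemma lprod_signs q e : signs q e -> Rabs (lprod e) = 1.
Proof.
  intros [_ H]. induction H as [|c e Hc _ IH]; simpl; [apply Rabs_R1|].
  rewrite Rabs_mult, Hc, IH. ring.
Qed.

Definition translate (v u : vec) : vec := vlin 1 u 1 v.

(* The slots carry arbitrary translations u_j so that the induction on the number of signs goes
   through: averaging over one sign gives a difference of two values of F, which telescopes over
   the slots. *)
Lemma polarization_translated y : forall m F us,
  mlin m F -> perm_invariant m F -> length us = m -> (m <= length y)%nat ->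
  sign_mean (length y) (fun e => lprod e * F (map (translate (lincomb e y)) us))
  = if (m =? length y)%nat then INR (fact m) * F y else 0.
Proof.
  induction y as [|y ys IH]; intros m F us HF HS Hus Hm.
  { simpl in Hm. replace m with 0%nat in * by lia. destruct us; [|easy]. simpl. ring. }
  simpl sign_mean. set (q := length ys) in *. simpl length in *. fold q. fold q in Hm.
  (* With no slots a constant is multiplied by a product containing the first sign, whose mean is
     zero. *)
  destruct m as [|m].
  { destruct us; [|easy]. simpl Nat.eqb. cbv iota. unfold lprod. simpl.
    rewrite !sign_mean_ext with (f := fun e => 1 * _ * _) (g := fun e => 1 * (fold_right Rmult 1 e * F nil))
      by (intros; ring).
    rewrite sign_mean_ext with (f := fun e => -1 * _ * _) (g := fun e => -1 * (fold_right Rmult 1 e * F nil))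
      by (intros; ring).
    rewrite !sign_mean_scal. field. }
  (* The average obtained once [y] occupies one slot; by induction it is the same for all
     translations in the other slots. *)
  set (K := if (m =? q)%nat then INR (fact m) * F (y :: ys) else 0).
  set (A := fun e => translate (lincomb (1 :: e) (y :: ys))).
  set (B := fun e => translate (lincomb (-1 :: e) (y :: ys))).
  assert (HA : forall e u, A e u = translate (lincomb e ys) (vlin 1 u 1 y)).
  { intros e u. unfold A, translate, vlin. simpl. unfold vlin.
    apply functional_extensionality. intros t. ring. }
  assert (HB : forall e u, B e u = translate (lincomb e ys) (vlin 1 u (-1) y)).
  { intros e u. unfold B, translate, vlin. simpl. unfold vlin.
    apply functional_extensionality. intros t. ring. }
  assert (HF' : mlin m (fun l => F (y :: l))).
  { intros a b u v al be Hl. apply (HF (y :: a) b u v al be). simpl. lia. }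
  assert (HS' : perm_invariant m (fun l => F (y :: l))).
  { intros l l' Hl HP. apply HS; [simpl; lia|now constructor]. }
  (* Slots in [l] already carry +y; those in [r] are switched from -y to +y one at a time. A switch
     changes F by twice its value with [y] in that slot, so it contributes 2K on average. *)
  assert (T : forall r l, (length l + length r)%nat = S m ->
    sign_mean q (fun e => lprod e * (F (map (A e) l ++ map (A e) r) - F (map (A e) l ++ map (B e) r)))
    = 2 * INR (length r) * K).
  { induction r as [|u r IHr]; intros l Hl.
    - rewrite (sign_mean_ext _ _ (fun _ => 0)); [rewrite sign_mean_const; simpl; ring|].
      intros; simpl; ring.
    - simpl length in Hl.
      assert (HK : sign_mean q (fun e => lprod e * F (y :: map (A e) l ++ map (B e) r)) = K).
      { unfold K. rewrite <- (IH m (fun l => F (y :: l))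
          (map (fun u => vlin 1 u 1 y) l ++ map (fun u => vlin 1 u (-1) y) r)); try easy.
        - fold q. apply sign_mean_ext. intros e _. do 3 f_equal.
          rewrite map_app, !map_map. f_equal; apply map_ext; intros; [apply HA|apply HB].
        - rewrite length_app, !length_map. lia.
        - fold q. lia. }
      specialize (IHr (l ++ u :: nil)).
      rewrite length_app in IHr. simpl length in IHr. specialize (IHr ltac:(lia)).
      rewrite (sign_mean_ext _ _ (fun e =>
        lprod e * (F (map (A e) (l ++ u :: nil) ++ map (A e) r)
                   - F (map (A e) (l ++ u :: nil) ++ map (B e) r))
        + 2 * (lprod e * F (y :: map (A e) l ++ map (B e) r)))).
      + rewrite sign_mean_plus, sign_mean_scal, HK, IHr. simpl length. rewrite S_INR. ring.
      + intros e _. rewrite map_app, <- !app_assoc. simpl.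
        assert (E : F (map (A e) l ++ A e u :: map (B e) r) - F (map (A e) l ++ B e u :: map (B e) r)
                    = 2 * F (y :: map (A e) l ++ map (B e) r)).
        { replace (A e u) with (vlin 1 (B e u) 2 y).
          2:{ rewrite HA, HB. unfold translate, vlin. apply functional_extensionality; intros; ring. }
          rewrite HF by (rewrite !length_map; lia).
          rewrite (HS (y :: map (A e) l ++ map (B e) r) (map (A e) l ++ y :: map (B e) r)); [ring| |].
          - simpl. rewrite length_app, !length_map. lia.
          - apply Permutation_middle. }
        replace (F (map (A e) l ++ A e u :: map (A e) r) - F (map (A e) l ++ B e u :: map (B e) r))
          with ((F (map (A e) l ++ A e u :: map (A e) r) - F (map (A e) l ++ A e u :: map (B e) r))
             + (F (map (A e) l ++ A e u :: map (B e) r) - F (map (A e) l ++ B e u :: map (B e) r)))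
          by ring.
        rewrite E. ring. }
  specialize (T us nil ltac:(simpl; lia)). simpl app in T. rewrite Hus in T.
  rewrite (sign_mean_ext _ _ (fun e => lprod e * F (map (A e) us) - lprod e * F (map (B e) us))) in T
    by (intros; ring).
  rewrite (sign_mean_minus q (fun e => lprod e * F (map (A e) us))) in T.
  change ((sign_mean q (fun e => lprod (1 :: e) * F (map (A e) us))
    + sign_mean q (fun e => lprod (-1 :: e) * F (map (B e) us))) / 2
    = if (m =? q)%nat then INR (fact (S m)) * F (y :: ys) else 0).
  rewrite (sign_mean_ext q (fun e => lprod (1 :: e) * F (map (A e) us))
    (fun e => lprod e * F (map (A e) us))) by (intros; simpl; ring).
  rewrite (sign_mean_ext q (fun e => lprod (-1 :: e) * F (map (B e) us))
    (fun e => -1 * (lprod e * F (map (B e) us)))) by (intros; simpl; ring).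
  rewrite sign_mean_scal, fact_simpl, mult_INR.
  unfold K in T. destruct (m =? q)%nat; lra.
Qed.

Lemma map_const_repeat {A B : Type} (f : A -> B) a m : map f (repeat a m) = repeat (f a) m.
Proof. induction m as [|m IH]; simpl; congruence. Qed.

Lemma polarization m F y :
  mlin m F -> perm_invariant m F -> length y = m ->
  INR (fact m) * F y = sign_mean m (fun e => lprod e * F (repeat (lincomb e y) m)).
Proof.
  intros HF HS Hy.
  pose proof (polarization_translated y m F (repeat (fun _ => 0) m) HF HS
    (repeat_length _ _) ltac:(lia)) as H.
  rewrite Hy, Nat.eqb_refl in H. rewrite <- H. apply sign_mean_ext. intros e _. do 2 f_equal.
  rewrite map_const_repeat. f_equal. unfold translate, vlin.
  apply functional_extensionality. intros; ring.
Qed.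

Lemma polarization_bound m F y g :
  mlin m F -> perm_invariant m F -> length y = m ->
  (forall e, signs m e -> Rabs (F (repeat (lincomb e y) m)) <= g e) ->
  Rabs (F y) <= sign_mean m g / INR (fact m).
Proof.
  intros HF HS Hy Hg. pose proof (INR_fact_lt_0 m) as Hf.
  apply Rmult_le_reg_l with (INR (fact m)); [easy|].
  replace (INR (fact m) * (sign_mean m g / INR (fact m))) with (sign_mean m g) by (field; lra).
  rewrite <- (Rabs_pos_eq (INR (fact m))) at 1 by lra. rewrite <- Rabs_mult, (polarization m) by easy.
  eapply Rle_trans; [apply sign_mean_Rabs|]. apply sign_mean_le. intros e He.
  rewrite Rabs_mult, (lprod_signs m e He), Rmult_1_l. now apply Hg.
Qed.

Definition vscal (c : R) (u : vec) : vec := fun t => c * u t.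

(** The prefix [a] collects the slots whose scalars have already been extracted. *)
Lemma mlin_scale m F (w : nat -> R) (y : nat -> vec) idx : mlin m F -> forall a,
  (length a + length idx)%nat = m ->
  F (a ++ map (fun i => vscal (w i) (y i)) idx) = lprod (map w idx) * F (a ++ map y idx).
Proof.
  intros HF. induction idx as [|i idx IH]; intros a Ha; [unfold lprod; simpl; ring|].
  change (lprod (map w (i :: idx))) with (w i * lprod (map w idx)). simpl in Ha |- *.
  replace (vscal (w i) (y i)) with (vlin (w i) (y i) 0 (y i))
    by (apply functional_extensionality; intros; unfold vlin, vscal; ring).
  rewrite HF by (rewrite length_map; lia).
  replace (a ++ y i :: map (fun i => vscal (w i) (y i)) idx)
    with ((a ++ y i :: nil) ++ map (fun i => vscal (w i) (y i)) idx) by now rewrite <- app_assoc.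
  rewrite IH by (rewrite length_app; simpl; lia). rewrite <- app_assoc. simpl. ring.
Qed.

Lemma mlin_scale_repeat m F c a : mlin m F ->
  F (repeat (vscal c a) m) = c ^ m * F (repeat a m).
Proof.
  intros HF. pose proof (mlin_scale m F (fun _ => c) (fun _ => a) (repeat 0%nat m) HF nil) as H.
  rewrite repeat_length in H. specialize (H eq_refl). simpl in H.
  rewrite !map_const_repeat in H. rewrite H. f_equal.
  clear. induction m as [|m IH]; [easy|]. simpl. now rewrite <- IH.
Qed.

(** * Spans of disjointly supported unit vectors *)

Lemma lp_norm_zero p : p_valid p -> lp_norm_is p (fun _ => 0) 0.
Proof.
  intros Hp. split; [lra|]. destruct p as [q|]; simpl in Hp.
  - rewrite Rabs_R0, rpow_0_l by lra. intros eps Heps. exists 0%nat. intros n _.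
    rewrite sum_cte, Rmult_0_l. unfold Rdist. rewrite Rminus_diag, Rabs_R0. easy.
  - split.
    + intros t [i ->]. rewrite Rabs_R0. lra.
    + intros b Hb. apply Hb. exists 0%nat. now rewrite Rabs_R0.
Qed.

Lemma infinite_sum_nonneg_term f l i :
  (forall j, 0 <= f j) -> infinite_sum f l -> f i <= l.
Proof.
  intros Hf Hl. apply Rle_trans with (sum_f_R0 f i).
  - destruct i; simpl; [lra|]. assert (0 <= sum_f_R0 f i) by now apply cond_pos_sum. lra.
  - apply (growing_ineq (sum_f_R0 f)); [|exact Hl]. intros n. simpl. specialize (Hf (S n)). lra.
Qed.

Lemma lp_norm_coord_le p x r i : p_valid p -> lp_norm_is p x r -> Rabs (x i) <= r.
Proof.
  intros Hp [Hr H]. destruct p as [q|]; simpl in Hp.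
  - apply (rpow_le_inv _ _ q); [lra|apply Rabs_pos|easy|].
    apply (infinite_sum_nonneg_term (fun i => rpow (Rabs (x i)) q)); [|easy].
    intros; apply rpow_nonneg.
  - apply H. now exists i.
Qed.

Lemma infinite_sum_rsum n c f l :
  (forall i, (i < n)%nat -> infinite_sum (f i) (l i)) ->
  infinite_sum (fun t => rsum n (fun i => c i * f i t)) (rsum n (fun i => c i * l i)).
Proof.
  induction n as [|n IH]; intros H; simpl.
  - intros eps Heps. exists 0%nat. intros n _.
    rewrite sum_cte, Rmult_0_l. unfold Rdist. rewrite Rminus_diag, Rabs_R0. easy.
  - assert (HU : Un_cv (fun N => sum_f_R0 (fun t => rsum n (fun i => c i * f i t)) N
                                 + c n * sum_f_R0 (f n) N)
                   (rsum n (fun i => c i * l i) + c n * l n)).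
    { apply CV_plus; [apply IH; intros; apply H; lia|].
      apply (CV_mult (fun _ => c n)); [|apply H; lia].
      intros eps Heps. exists 0%nat. intros. unfold Rdist. now rewrite Rminus_diag, Rabs_R0. }
    intros eps Heps. destruct (HU eps Heps) as [N0 HN]. exists N0. intros N HNN.
    specialize (HN N HNN). rewrite scal_sum, <- sum_plus in HN.
    erewrite sum_eq; [exact HN|]. intros; simpl; ring.
Qed.

Definition comb (n : nat) (x : nat -> vec) (a : vec) : vec :=
  fun t => rsum n (fun i => a i * x i t).

Definition pullback (n : nat) (x : nat -> vec) (L : form) : form :=
  fun l => L (map (comb n x) l).

Definition unit_disjoint (p : extp) (n : nat) (x : nat -> vec) : Prop :=
  (forall i, (i < n)%nat -> lp_norm_is p (x i) 1) /\ disjoint_supports n x.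

Lemma disjoint_single n x t : disjoint_supports n x ->
  exists j, forall i, (i < n)%nat -> i <> j -> x i t = 0.
Proof.
  intros H. destruct (classic (exists j, (j < n)%nat /\ x j t <> 0)) as [[j [Hj Hx]]|Hno].
  - exists j. intros i Hi Hij. destruct (H i j Hi Hj Hij t); easy.
  - exists 0%nat. intros i Hi _. apply NNPP. intros Hx. apply Hno. now exists i.
Qed.

(** At each coordinate at most one summand is nonzero, so the q-th power of the sum is the sum of
    the q-th powers; each unit vector then contributes its coefficient's power. *)
Lemma comb_norm_fin q n x a : 1 <= q -> unit_disjoint (PFin q) n x ->
  lp_norm_is (PFin q) (comb n x a) (rpow (rsum n (fun i => rpow (Rabs (a i)) q)) (/ q)).
Proof.
  intros Hq [Hx Hd]. split; [apply rpow_nonneg|].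
  assert (HS : 0 <= rsum n (fun i => rpow (Rabs (a i)) q))
    by (apply rsum_nonneg; intros; apply rpow_nonneg).
  rewrite rpow_rpow by (try apply Rinv_neq_0_compat; lra).
  rewrite Rinv_l, rpow_1_r by lra.
  assert (E : (fun t => rpow (Rabs (comb n x a t)) q)
              = (fun t => rsum n (fun i => rpow (Rabs (a i)) q * rpow (Rabs (x i t)) q))).
  { apply functional_extensionality. intros t. destruct (disjoint_single n x t Hd) as [j Hj].
    unfold comb. rewrite (rsum_single n _ j), (rsum_single n (fun i => _ * rpow _ q) j).
    - destruct (lt_dec j n); [|now rewrite Rabs_R0, rpow_0_l by lra].
      rewrite Rabs_mult. apply rpow_mult_l; apply Rabs_pos.
    - intros i Hi Hij. rewrite Hj, Rabs_R0, rpow_0_l by (lra || easy). ring.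
    - intros i Hi Hij. rewrite Hj by easy. ring. }
  rewrite E.
  rewrite (rsum_ext n _ (fun i => rpow (Rabs (a i)) q * 1)) by (intros; ring).
  apply infinite_sum_rsum. intros i Hi. destruct (Hx i Hi) as [_ H]. now rewrite rpow_1_l in H.
Qed.

Lemma comb_norm_inf n x a M : 0 <= M -> unit_disjoint PInf n x ->
  (forall i, (i < n)%nat -> Rabs (a i) <= M) ->
  exists r, lp_norm_is PInf (comb n x a) r /\ r <= M.
Proof.
  intros HM [Hx Hd] Ha.
  assert (HB : is_upper_bound (fun t => exists i, t = Rabs (comb n x a i)) M).
  { intros t [i ->]. destruct (disjoint_single n x i Hd) as [j Hj].
    unfold comb. rewrite (rsum_single n _ j).
    - destruct (lt_dec j n) as [Hjn|]; [|now rewrite Rabs_R0]. rewrite Rabs_mult.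
      pose proof (lp_norm_coord_le PInf (x j) 1 i I (Hx j Hjn)).
      pose proof (Ha j Hjn). pose proof (Rabs_pos (a j)). pose proof (Rabs_pos (x j i)). nra.
    - intros i' Hi Hij. rewrite Hj by easy. ring. }
  destruct (completeness (fun t => exists i, t = Rabs (comb n x a i))) as [r Hr].
  - now exists M.
  - exists (Rabs (comb n x a 0%nat)). now exists 0%nat.
  - exists r. split; [|now apply Hr]. split; [|easy].
    apply Rle_trans with (Rabs (comb n x a 0%nat)); [apply Rabs_pos|]. apply Hr. now exists 0%nat.
Qed.

Lemma comb_in_lp p n x a : p_valid p -> unit_disjoint p n x -> in_lp p (comb n x a).
Proof.
  intros Hp Hx. destruct p as [q|].
  - eexists. now apply comb_norm_fin.
  - destruct (comb_norm_inf n x a (rsum n (fun i => Rabs (a i)))) as [r [Hr _]].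
    + apply rsum_nonneg. intros; apply Rabs_pos.
    + easy.
    + intros i Hi. apply (rsum_term_le n (fun i => Rabs (a i))); [intros; apply Rabs_pos|easy].
    + now exists r.
Qed.

Lemma comb_vlin n x al u be v :
  comb n x (vlin al u be v) = vlin al (comb n x u) be (comb n x v).
Proof.
  apply functional_extensionality. intros t. unfold comb, vlin.
  rewrite <- (rsum_lin n al be (fun i => u i * x i t) (fun i => v i * x i t)).
  apply rsum_ext. intros; ring.
Qed.

Lemma Forall_comb_in_lp p n x l : p_valid p -> unit_disjoint p n x ->
  Forall (in_lp p) (map (comb n x) l).
Proof.
  intros Hp Hx. apply Forall_map, Forall_forall. intros u _. now apply comb_in_lp.
Qed.

Lemma pullback_mlin p m L n x : p_valid p -> unit_disjoint p n x ->
  sym_mlin_form p m L -> mlin m (pullback n x L).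
Proof.
  intros Hp Hx [HL _] a b u v al be Hl. unfold pullback. rewrite !map_app. simpl.
  rewrite comb_vlin.
  apply HL; try (now apply Forall_comb_in_lp); try (now apply comb_in_lp).
  now rewrite !length_map.
Qed.

Lemma pullback_perm p m L n x : p_valid p -> unit_disjoint p n x ->
  sym_mlin_form p m L -> perm_invariant m (pullback n x L).
Proof.
  intros Hp Hx (_ & HS & _) l l' Hl HP. unfold pullback. apply HS; [|now apply Permutation_map].
  split; [now rewrite length_map|]. now apply Forall_comb_in_lp.
Qed.

Lemma hat_lub_nonneg p m L N : p_valid p -> is_lub (hat_values p m L) N -> 0 <= N.
Proof.
  intros Hp [HN _]. apply Rle_trans with (Rabs (L (repeat (fun _ => 0) m))); [apply Rabs_pos|].
  apply HN. exists (fun _ => 0), 0. split; [now apply lp_norm_zero|]. split; [lra|easy].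
Qed.

(** Homogeneity of degree m: normalize the combination, whose norm is that of its coefficients, and
    scale back. *)
Lemma hat_bound_fin q m L n x N a :
  1 <= q -> (1 <= m)%nat -> unit_disjoint (PFin q) n x -> sym_mlin_form (PFin q) m L ->
  is_lub (hat_values (PFin q) m L) N ->
  Rabs (pullback n x L (repeat a m))
  <= rpow (rsum n (fun i => rpow (Rabs (a i)) q)) (INR m / q) * N.
Proof.
  intros Hq Hm Hx HL HN.
  pose proof (pullback_mlin (PFin q) m L n x Hq Hx HL) as HF.
  assert (HS : 0 <= rsum n (fun i => rpow (Rabs (a i)) q))
    by (apply rsum_nonneg; intros; apply rpow_nonneg).
  destruct (Req_dec (rsum n (fun i => rpow (Rabs (a i)) q)) 0) as [HS0|HS0].
  - assert (Ha : forall i, (i < n)%nat -> a i = 0).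
    { intros i Hi. apply NNPP. intros Hai. assert (0 < rpow (Rabs (a i)) q)
        by now apply rpow_gt0, Rabs_pos_lt.
      pose proof (rsum_term_le n (fun i => rpow (Rabs (a i)) q) i
        ltac:(intros; apply rpow_nonneg) Hi). simpl in *. lra. }
    (* A null combination cannot be normalized. Since [a] may be nonzero beyond [n], the vanishing
       shows only after applying [comb]; then 0^m = 0 because m >= 1. *)
    assert (E : pullback n x L (repeat a m) = pullback n x L (repeat (vscal 0 a) m)).
    { unfold pullback. rewrite !map_const_repeat. do 2 f_equal.
      apply functional_extensionality. intros t. apply rsum_ext. intros i Hi.
      unfold vscal. rewrite Ha by easy. ring. }
    rewrite E, (mlin_scale_repeat m) by easy. rewrite pow_i by lia.
    rewrite Rmult_0_l, Rabs_R0. apply Rmult_le_pos; [apply rpow_nonneg|].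
    now apply (hat_lub_nonneg (PFin q) m L).
  - set (S := rsum n (fun i => rpow (Rabs (a i)) q)) in *.
    assert (Hr : 0 < rpow S (/ q)) by (apply rpow_gt0; lra). set (r := rpow S (/ q)) in *.
    assert (Hr' : 0 < / r) by now apply Rinv_0_lt_compat.
    assert (H1 : Rabs (pullback n x L (repeat (vscal (/ r) a) m)) <= N).
    { apply HN. exists (comb n x (vscal (/ r) a)), 1. split; [|split; [lra|]].
      - pose proof (comb_norm_fin q n x (vscal (/ r) a) Hq Hx) as H.
        rewrite (rsum_ext n _ (fun i => rpow (/ r) q * rpow (Rabs (a i)) q)) in H.
        2:{ intros i _. unfold vscal. rewrite Rabs_mult, (Rabs_pos_eq (/ r)) by lra.
            apply rpow_mult_l; [lra|apply Rabs_pos]. }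
        rewrite rsum_scal in H. fold S in H.
        replace (rpow (/ r) q * S) with 1 in H; [now rewrite rpow_1_l in H|].
        replace S with (rpow r q).
        2:{ unfold r. rewrite rpow_rpow by (try apply Rinv_neq_0_compat; lra).
            rewrite Rinv_l by lra. now apply rpow_1_r. }
        rewrite <- rpow_mult_l by lra. rewrite Rinv_l, rpow_1_l; lra.
      - unfold pullback. now rewrite map_const_repeat. }
    rewrite (mlin_scale_repeat m) in H1 by easy.
    rewrite Rabs_mult, <- RPow_abs, (Rabs_pos_eq (/ r)) in H1 by lra.
    replace (rpow S (INR m / q)) with (r ^ m).
    2:{ unfold Rdiv. rewrite <- rpow_INR by lra. unfold r.
        rewrite rpow_rpow by (try apply Rinv_neq_0_compat; lra). f_equal. ring. }
    pose proof (pow_lt r m Hr) as Hrm.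
    apply (Rmult_le_compat_l (r ^ m)) in H1; [|lra].
    rewrite <- Rmult_assoc, <- Rpow_mult_distr, Rinv_r, pow1, Rmult_1_l in H1 by lra. easy.
Qed.

(** Coefficients bounded by 1 have l_p norm at most n^(1/p), and degree m turns this into n^(m/p);
    for p = infinity they stay in the unit ball. *)
Lemma hat_bound_unit p m L n x N a :
  p_valid p -> (1 <= m)%nat -> unit_disjoint p n x -> sym_mlin_form p m L ->
  is_lub (hat_values p m L) N -> (forall i, (i < n)%nat -> Rabs (a i) <= 1) ->
  Rabs (pullback n x L (repeat a m)) <= ppow p (INR n) (INR m) * N.
Proof.
  intros Hp Hm Hx HL HN Ha. pose proof (hat_lub_nonneg p m L N Hp HN) as HN0.
  destruct p as [q|]; simpl in *.
  - eapply Rle_trans; [now apply (hat_bound_fin q m L n x N)|].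
    apply Rmult_le_compat_r; [easy|]. apply rpow_le_l.
    { apply Rdiv_lt_0_compat; [apply lt_0_INR; lia|lra]. }
    split; [apply rsum_nonneg; intros; apply rpow_nonneg|].
    rewrite <- (Rmult_1_r (INR n)), <- rsum_const. apply rsum_le. intros i Hi.
    rewrite <- (rpow_1_l q). apply rpow_le_l; [lra|]. split; [apply Rabs_pos|now apply Ha].
  - rewrite Rmult_1_l. destruct (comb_norm_inf n x a 1) as [r [Hr Hr1]]; try easy; try lra.
    apply HN. exists (comb n x a), r. unfold pullback. now rewrite map_const_repeat.
Qed.

(** * The upper bounds *)

Definition block_idx (n : nat) (k : nat -> nat) : list nat :=
  flat_map (fun i => repeat i (k i)) (seq 0 n).

Definition unit_vec (i : nat) : vec := fun j => if Nat.eq_dec i j then 1 else 0.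

Lemma block_idx_S n k : block_idx (S n) k = block_idx n k ++ repeat n (k n).
Proof.
  unfold block_idx. rewrite seq_S, flat_map_app. simpl. now rewrite app_nil_r.
Qed.

Lemma length_block_idx n k : length (block_idx n k) = sumk n k.
Proof.
  induction n as [|n IH]; [easy|].
  now rewrite block_idx_S, length_app, repeat_length, IH, sumk_S.
Qed.

Lemma block_idx_lt n k i : In i (block_idx n k) -> (i < n)%nat.
Proof.
  intros H. apply in_flat_map in H as (j & Hj & Hi). apply repeat_spec in Hi as ->.
  apply in_seq in Hj. lia.
Qed.

Lemma args_of_map n k x : args_of n k x = map x (block_idx n k).
Proof.
  unfold args_of, block_idx. induction (seq 0 n) as [|i l IH]; [easy|]. simpl.
  now rewrite map_app, IH, map_const_repeat.
Qed.

Lemma lprod_block_idx n k w :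
  lprod (map w (block_idx n k)) = prodR n (fun i => w i ^ k i).
Proof.
  assert (App : forall a b, lprod (a ++ b) = lprod a * lprod b).
  { induction a as [|c a IH]; intros b; unfold lprod in *; simpl; [ring|]. rewrite IH. ring. }
  induction n as [|n IH]; [easy|]. rewrite block_idx_S, map_app, App, IH, prodR_S. f_equal.
  induction (k n) as [|j IHj]; [easy|]. simpl. rewrite <- IHj. easy.
Qed.

Definition lsum (l : list R) : R := fold_right Rplus 0 l.

Lemma lsum_block_idx n k w :
  lsum (map w (block_idx n k)) = rsum n (fun i => INR (k i) * w i).
Proof.
  assert (App : forall a b, lsum (a ++ b) = lsum a + lsum b).
  { induction a as [|c a IH]; intros b; unfold lsum in *; simpl; [ring|]. rewrite IH. ring. }
  induction n as [|n IH]; [easy|]. rewrite block_idx_S, map_app, App, IH. simpl. f_equal.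
  induction (k n) as [|j IHj]; [simpl; unfold lsum; simpl; ring|]. rewrite S_INR. simpl repeat.
  change (lsum (map w (n :: repeat n j))) with (w n + lsum (map w (repeat n j))).
  rewrite IHj. ring.
Qed.

Lemma sqnorm_lsum c : sqnorm c = lsum (map (fun y => y * y) c).
Proof. induction c as [|y c IH]; [easy|]. simpl. rewrite IH. easy. Qed.

Lemma dot_signs_le q e c : signs q e -> Rabs (dot e c) <= lsum (map Rabs c).
Proof.
  intros [_ He]. revert c. induction He as [|s e Hs _ IH]; intros [|y c]; simpl;
    try (rewrite Rabs_R0); unfold lsum; simpl; try lra.
  - assert (E : forall c, 0 <= fold_right Rplus 0 (map Rabs c)).
    { clear. induction c; simpl; [lra|]. pose proof (Rabs_pos a). lra. }
    specialize (E c). pose proof (Rabs_pos y). lra.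
  - specialize (IH c). eapply Rle_trans; [apply Rabs_triang|]. rewrite Rabs_mult, Hs.
    unfold lsum in IH. lra.
Qed.

Lemma pullback_args n k x L :
  pullback n x L (map unit_vec (block_idx n k)) = L (args_of n k x).
Proof.
  unfold pullback. rewrite args_of_map, map_map. f_equal. apply map_ext_in.
  intros i Hi. apply block_idx_lt in Hi. apply functional_extensionality. intros t.
  unfold comb, unit_vec. rewrite (rsum_single n _ i).
  - destruct (lt_dec i n); [|lia]. destruct (Nat.eq_dec i i); [ring|easy].
  - intros j _ Hj. destruct (Nat.eq_dec i j); [congruence|ring].
Qed.

(* Block i has coefficients 1/k_i, so that every signed sum lies in the sup-norm unit ball. *)
Lemma upper_A_admissible p n k : p_valid p -> (1 <= sumk n k)%nat ->
  admissible p n k (upper_A p n k (sumk n k)).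
Proof.
  intros Hp Hm L HL N HN x Hx Hd. set (m := sumk n k) in *.
  pose proof (conj Hx Hd : unit_disjoint p n x) as Hu.
  pose proof (pullback_mlin p m L n x Hp Hu HL) as HF.
  pose proof (pullback_perm p m L n x Hp Hu HL) as HS.
  rewrite <- pullback_args. set (F := pullback n x L) in *.
  set (y := map (fun i => vscal (/ INR (k i)) (unit_vec i)) (block_idx n k)).
  assert (Hy : Rabs (F y) <= ppow p (INR n) (INR m) * N / INR (fact m)).
  { rewrite <- (sign_mean_const m (ppow p (INR n) (INR m) * N)).
    apply polarization_bound; try easy.
    { unfold y. now rewrite length_map, length_block_idx. }
    intros e He. apply hat_bound_unit; try easy. intros j Hj.
    rewrite lincomb_coord. eapply Rle_trans; [now apply (dot_signs_le m)|].
    unfold y. rewrite !map_map.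
    rewrite (lsum_block_idx n k (fun i => Rabs (vscal (/ INR (k i)) (unit_vec i) j))).
    rewrite (rsum_single n _ j).
    - destruct (lt_dec j n); [|lia]. unfold vscal, unit_vec.
      destruct (Nat.eq_dec j j); [|easy]. rewrite Rmult_1_r.
      (* An empty block contributes 0, whatever the value of [/ 0]. *)
      destruct (Nat.eq_dec (k j) 0) as [->|Hk]; [simpl; lra|].
      assert (0 < INR (k j)) by (apply lt_0_INR; lia).
      rewrite Rabs_pos_eq by (left; now apply Rinv_0_lt_compat). rewrite Rinv_r; lra.
    - intros i _ Hij. unfold vscal, unit_vec. destruct (Nat.eq_dec i j); [easy|].
      rewrite Rmult_0_r, Rabs_R0. ring. }
  assert (E : F (map unit_vec (block_idx n k)) = prodR n (fun i => INR (k i) ^ k i) * F y).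
  { unfold y.
    pose proof (mlin_scale m F (fun i => / INR (k i)) unit_vec (block_idx n k) HF nil
      ltac:(simpl; apply length_block_idx)) as H. simpl app in H. rewrite H.
    rewrite lprod_block_idx, <- Rmult_assoc, <- prodR_mult.
    rewrite (prodR_ext n _ (fun _ => 1)).
    - replace (prodR n (fun _ => 1)) with 1; [ring|]. clear.
      induction n as [|n IH]; [easy|]. rewrite prodR_S, <- IH. ring.
    - intros i _. rewrite <- Rpow_mult_distr.
      destruct (Nat.eq_dec (k i) 0) as [->|Hk]; [easy|].
      rewrite Rinv_r by (apply not_0_INR; easy). apply pow1. }
  rewrite E, Rabs_mult.
  assert (HP : 0 < prodR n (fun i => INR (k i) ^ k i)).
  { apply prodR_pos. intros i _. destruct (Nat.eq_dec (k i) 0) as [->|Hk]; [simpl; lra|].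
    apply pow_lt, lt_0_INR. lia. }
  rewrite Rabs_pos_eq by lra. unfold upper_A. fold m.
  apply Rle_trans with (prodR n (fun i => INR (k i) ^ k i)
    * (ppow p (INR n) (INR m) * N / INR (fact m))).
  - apply Rmult_le_compat_l; lra.
  - right. field. apply INR_fact_neq_0.
Qed.

(** For m >= 2, k_i^(m/2) <= k_i m^(m/2 - 1), and the k_i add up to m. For m = 1 the exponent m/2 -
    1 is negative, but each k_i is 0 or 1. *)
Lemma rsum_sqrt_pow_le n k : (1 <= sumk n k)%nat ->
  rsum n (fun i => sqrt (INR (k i)) ^ sumk n k) <= sqrt (INR (sumk n k)) ^ sumk n k.
Proof.
  intros Hm. set (m := sumk n k) in *. assert (HM : 1 <= INR m) by (apply (le_INR 1); lia).
  apply Rle_trans with (rsum n (fun i => (sqrt (INR m) ^ m / INR m) * INR (k i))).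
  - apply rsum_le. intros i Hi. assert (Hk : (k i <= m)%nat) by now apply sumk_term_le.
    assert (Hk' : INR (k i) <= INR m) by now apply le_INR. pose proof (pos_INR (k i)) as Hk0.
    destruct (Nat.eq_dec m 1) as [E|Hm1].
    + rewrite E in *. simpl INR in *. rewrite sqrt_1, !pow_1.
      assert (k i = 0%nat \/ k i = 1%nat) as [-> | ->] by lia; simpl.
      * rewrite sqrt_0. lra.
      * rewrite sqrt_1. lra.
    + replace m with (S (S (m - 2))) at 1 3 by lia. simpl pow.
      rewrite <- !Rmult_assoc, !sqrt_sqrt by lra.
      replace (INR m * sqrt (INR m) ^ (m - 2) / INR m * INR (k i))
        with (INR (k i) * sqrt (INR m) ^ (m - 2)) by (field; lra).
      apply Rmult_le_compat_l; [easy|]. apply pow_incr.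
      split; [apply sqrt_pos|now apply sqrt_le_1_alt].
  - rewrite rsum_scal, <- INR_sumk. fold m. right. field. lra.
Qed.

(** Monotonicity of l_p norms, raised to the power s. With tau the l_s norm, b_i <= tau gives b_i^r
    <= tau^(r-s) b_i^s, and summation gives tau^r. *)
Lemma rpow_rsum_le_rsum_rpow n b r s : 0 < s -> s <= r -> (forall i, (i < n)%nat -> 0 <= b i) ->
  rpow (rsum n (fun i => rpow (b i) r)) (s / r) <= rsum n (fun i => rpow (b i) s).
Proof.
  intros Hs Hsr Hb. set (T := rsum n (fun i => rpow (b i) s)).
  assert (HT : 0 <= T) by (apply rsum_nonneg; intros; apply rpow_nonneg).
  set (tau := rpow T (/ s)). assert (Htau : 0 <= tau) by apply rpow_nonneg.
  assert (Hsi : / s <> 0) by (apply Rinv_neq_0_compat; lra).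
  assert (ET : rpow tau s = T).
  { unfold tau. rewrite rpow_rpow by easy. rewrite Rinv_l by lra. now apply rpow_1_r. }
  rewrite <- ET at 1. replace (rpow tau s) with (rpow (rpow tau r) (s / r)).
  2:{ rewrite rpow_rpow by lra. f_equal. field. lra. }
  apply rpow_le_l; [apply Rdiv_lt_0_compat; lra|].
  split; [apply rsum_nonneg; intros; apply rpow_nonneg|].
  destruct (Req_dec r s) as [->|Hrs]; [rewrite ET; unfold T; lra|].
  assert (Hsplit : forall a, 0 <= a -> rpow a r = rpow a (r - s) * rpow a s).
  { intros a [Ha| <-]; [rewrite <- rpow_plus by easy; f_equal; ring|].
    rewrite !rpow_0_l by lra. ring. }
  rewrite Hsplit, ET by easy. unfold T. rewrite <- rsum_scal. apply rsum_le. intros i Hi.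
  rewrite Hsplit by now apply Hb. apply Rmult_le_compat_r; [apply rpow_nonneg|].
  apply rpow_le_l; [lra|]. split; [now apply Hb|].
  apply (rpow_le_inv _ _ s); try easy; [now apply Hb|]. rewrite ET.
  apply (rsum_term_le n (fun i => rpow (b i) s)); [intros; apply rpow_nonneg|easy].
Qed.

(** For y = 1 + t(x - 1) > 0, add ln(y/x) <= y/x - 1 to t - 1 times ln(1/x) <= 1/x - 1: the
    right-hand sides cancel, leaving ln y <= t ln x. *)
Lemma bernoulli_rpow x t : 0 <= x -> 1 <= t -> 1 + t * (x - 1) <= rpow x t.
Proof.
  intros [Hx| <-] Ht; [|rewrite rpow_0_l; lra].
  destruct (Rle_dec (1 + t * (x - 1)) 0) as [H|H]; [pose proof (rpow_nonneg x t); lra|].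
  set (y := 1 + t * (x - 1)) in *. assert (Hy : 0 < y) by lra.
  assert (Hix : 0 < / x) by now apply Rinv_0_lt_compat.
  pose proof (ln_le_sub1 (y * / x) ltac:(now apply Rmult_lt_0_compat)) as H1.
  pose proof (ln_le_sub1 (/ x) Hix) as H2.
  rewrite ln_mult in H1 by easy. rewrite ln_Rinv in H1, H2 by easy.
  assert (H3 : (t - 1) * - ln x <= (t - 1) * (/ x - 1)) by (apply Rmult_le_compat_l; lra).
  assert (E : y * / x - 1 + (t - 1) * (/ x - 1) = 0) by (unfold y; field; lra).
  rewrite rpow_pos by easy. rewrite <- (exp_ln y Hy). unfold Rpower.
  assert (H4 : ln y <= t * ln x) by lra.
  destruct H4 as [H4| ->]; [left; now apply exp_increasing|lra].
Qed.

(** Each b_i^t lies above the tangent of u^t at the average A of the b_i; the linear terms cancel in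
    the sum. *)
Lemma power_mean n b t : 1 <= t -> (forall i, (i < n)%nat -> 0 <= b i) ->
  rpow (rsum n b) t <= rpow (INR n) (t - 1) * rsum n (fun i => rpow (b i) t).
Proof.
  intros Ht Hb. pose proof (rsum_nonneg n b Hb) as HS.
  assert (HR : 0 <= rsum n (fun i => rpow (b i) t))
    by (apply rsum_nonneg; intros; apply rpow_nonneg).
  destruct (Req_dec (rsum n b) 0) as [H0|H0].
  { rewrite H0, rpow_0_l by lra. apply Rmult_le_pos; [apply rpow_nonneg|easy]. }
  assert (Hn : 0 < INR n). { apply lt_0_INR. destruct n; [easy|lia]. }
  set (A := rsum n b / INR n). assert (HA : 0 < A) by (apply Rdiv_lt_0_compat; lra).
  assert (H : INR n * rpow A t <= rsum n (fun i => rpow (b i) t)).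
  { apply Rle_trans with
      (rsum n (fun i => (rpow A t * (1 - t)) * 1 + (rpow A t * t / A) * b i)).
    - rewrite (rsum_lin n _ _ (fun _ => 1) b), rsum_const.
      replace (rsum n b) with (INR n * A) by (unfold A; field; lra).
      right. field. lra.
    - apply rsum_le. intros i Hi. specialize (Hb i Hi).
      assert (0 <= b i / A) by (apply Rmult_le_pos; [easy|left; now apply Rinv_0_lt_compat]).
      replace (rpow (b i) t) with (rpow A t * rpow (b i / A) t).
      2:{ rewrite <- rpow_mult_l by lra. f_equal. field. lra. }
      apply Rle_trans with (rpow A t * (1 + t * (b i / A - 1))).
      + right. field. lra.
      + apply Rmult_le_compat_l; [apply rpow_nonneg|]. now apply bernoulli_rpow. }
  replace (rsum n b) with (INR n * A) by (unfold A; field; lra).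
  rewrite rpow_mult_l by lra. replace t with (t - 1 + 1) at 1 by ring.
  rewrite rpow_plus, rpow_1_r, Rmult_assoc by lra.
  apply Rmult_le_compat_l; [apply rpow_nonneg|easy].
Qed.

(** The coefficient list of coordinate i is the indicator of block i, of squared norm k_i, so
    Khinchine gives k_i^(m/2). *)
Lemma block_moment_bound n k : (1 <= sumk n k)%nat ->
  sign_mean (sumk n k) (fun e => rsum n (fun i =>
     Rabs (lincomb e (map unit_vec (block_idx n k)) i) ^ sumk n k))
  <= khinchine_const (sumk n k) * sqrt (INR (sumk n k)) ^ sumk n k.
Proof.
  intros Hm. set (m := sumk n k) in *.
  rewrite (sign_mean_rsum m n (fun e i => Rabs (lincomb e (map unit_vec (block_idx n k)) i) ^ m)).
  apply Rle_trans with (rsum n (fun i => khinchine_const m * sqrt (INR (k i)) ^ m)).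
  - apply rsum_le. intros i Hi.
    set (c := map (fun u : vec => u i) (map unit_vec (block_idx n k))).
    assert (Hc : length c = m) by (unfold c; now rewrite !length_map, length_block_idx).
    assert (Hq : sqnorm c = INR (k i)).
    { unfold c. rewrite sqnorm_lsum, !map_map.
      rewrite (lsum_block_idx n k (fun j => unit_vec j i * unit_vec j i)), (rsum_single n _ i).
      - destruct (lt_dec i n); [|lia]. unfold unit_vec. destruct (Nat.eq_dec i i); [ring|easy].
      - intros j _ Hj. unfold unit_vec. destruct (Nat.eq_dec j i); [easy|ring]. }
    rewrite <- Hq. rewrite <- Hc at 1.
    rewrite (sign_mean_ext _ _ (fun e => Rabs (dot e c) ^ m)); [now apply khinchine|].
    intros e _. now rewrite lincomb_coord.
  - rewrite rsum_scal. apply Rmult_le_compat_l; [|now apply rsum_sqrt_pow_le].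
    pose proof (khinchine_const_ge_1 m Hm). lra.
Qed.

(** [C] isolates the passage from exponent r to exponent m, whose form depends on whether r >= m. *)
Lemma moment_admissible r n k C : 1 <= r -> (1 <= sumk n k)%nat ->
  (forall b, (forall i, 0 <= b i) ->
     rpow (rsum n (fun i => rpow (b i) r)) (INR (sumk n k) / r)
     <= C * rsum n (fun i => b i ^ sumk n k)) -> 0 <= C ->
  admissible (PFin r) n k
    (C * (khinchine_const (sumk n k) * sqrt (INR (sumk n k)) ^ sumk n k) / INR (fact (sumk n k))).
Proof.
  intros Hr Hm HC HC0 L HL N HN x Hx Hd. set (m := sumk n k) in *.
  pose proof (conj Hx Hd : unit_disjoint (PFin r) n x) as Hu.
  pose proof (hat_lub_nonneg (PFin r) m L N Hr HN) as HN0.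
  rewrite <- pullback_args.
  eapply Rle_trans.
  - apply (polarization_bound m) with (g := fun e =>
      C * N * rsum n (fun i => Rabs (lincomb e (map unit_vec (block_idx n k)) i) ^ m)).
    + now apply (pullback_mlin (PFin r)).
    + now apply (pullback_perm (PFin r)).
    + now rewrite length_map, length_block_idx.
    + intros e He. eapply Rle_trans; [now apply (hat_bound_fin r m L n x N)|].
      rewrite (Rmult_comm C N), Rmult_assoc, Rmult_comm. apply Rmult_le_compat_l; [easy|].
      apply (HC (fun i => Rabs (lincomb e (map unit_vec (block_idx n k)) i))).
      intros; apply Rabs_pos.
  - rewrite sign_mean_scal. pose proof (block_moment_bound n k Hm) as H. fold m in H.
    pose proof (INR_fact_lt_0 m) as Hf.
    apply Rmult_le_reg_r with (INR (fact m)); [easy|].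
    unfold Rdiv. rewrite Rmult_assoc, Rinv_l, Rmult_1_r by lra.
    apply Rle_trans with (C * N * (khinchine_const m * sqrt (INR m) ^ m)).
    + apply Rmult_le_compat_l; [now apply Rmult_le_pos|easy].
    + right. field. lra.
Qed.

Lemma admissible_le p n k c c' : p_valid p -> c <= c' -> admissible p n k c -> admissible p n k c'.
Proof.
  intros Hp Hc H L HL N HN x Hx Hd. eapply Rle_trans; [exact (H L HL N HN x Hx Hd)|].
  apply Rmult_le_compat_r; [now apply (hat_lub_nonneg p (sumk n k) L)|easy].
Qed.

Lemma upper_bound_admissible p n k : p_valid p -> (1 <= sumk n k)%nat ->
  admissible p n k (upper_bound p n k (sumk n k)).
Proof.
  intros Hp Hm. pose proof (upper_A_admissible p n k Hp Hm) as HA.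
  destruct p as [r|]; [|exact HA]. simpl in Hp. unfold upper_bound.
  set (m := sumk n k) in *. assert (HM : 1 <= INR m) by (apply (le_INR 1); lia).
  pose proof (INR_fact_lt_0 m) as Hf.
  destruct (Rle_dec (INR m) r) as [Hmr|Hmr]; apply Rmin_case; try exact HA.
  - eapply admissible_le; [exact Hp| |apply (moment_admissible r n k 1); try easy; try lra].
    + rewrite Rmult_1_l. fold m. apply Rmult_le_compat_r; [left; now apply Rinv_0_lt_compat|].
      now apply khinchine_const_growth.
    + intros b Hb. fold m. rewrite Rmult_1_l.
      eapply Rle_trans; [apply rpow_rsum_le_rsum_rpow; try lra; intros; apply Hb|].
      right. apply rsum_ext. intros; now apply rpow_INR.
  - eapply admissible_le; [exact Hp| |apply (moment_admissible r n k
      (rpow (INR n) ((INR m - r) / r))); try easy; try apply rpow_nonneg].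
    + fold m. rewrite (rpow_half (INR m)) by lra. unfold khinchine_const. right. field. lra.
    + intros b Hb. fold m.
      (* The exponent t - 1 of the power mean inequality at t = m/r. *)
      replace ((INR m - r) / r) with (INR m / r - 1) by (field; lra).
      eapply Rle_trans; [apply power_mean; [|intros; apply rpow_nonneg]|].
      * apply Rmult_le_reg_r with r; [lra|]. unfold Rdiv. rewrite Rmult_assoc, Rinv_l; lra.
      * right. f_equal. apply rsum_ext. intros i _. rewrite rpow_rpow by (try apply Hb; lra).
        replace (r * (INR m / r)) with (INR m) by (field; lra). now apply rpow_INR.
Qed.

(** * The lower bound *)

(** Lowers the exponent of X_i after a derivative. Truncation at 0 is harmless in [polar], where the
    factor [INR (k i)] then vanishes. *)
Definition decr (k : nat -> nat) (i : nat) : nat -> nat :=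
  fun j => if Nat.eq_dec i j then (k j - 1)%nat else k j.

(* The iterated directional derivative of X_0^(k_0) ... X_(n-1)^(k_(n-1)) along the vectors of l,
   that is, m! times the polar form of this monomial. *)
Fixpoint polar (n : nat) (l : list vec) (k : nat -> nat) : R :=
  match l with
  | nil => 1
  | v :: l => rsum n (fun i => INR (k i) * v i * polar n l (decr k i))
  end.

Lemma polar_vlin n a b u v al be : forall k,
  polar n (a ++ vlin al u be v :: b) k
  = al * polar n (a ++ u :: b) k + be * polar n (a ++ v :: b) k.
Proof.
  induction a as [|w a IH]; intros k; simpl.
  - rewrite <- rsum_lin. apply rsum_ext. intros. unfold vlin. ring.
  - rewrite <- rsum_lin. apply rsum_ext. intros. rewrite IH. ring.
Qed.

Lemma polar_perm n l l' : Permutation l l' -> forall k, polar n l k = polar n l' k.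
Proof.
  intros HP. induction HP as [|v l l' _ IH|u v l|l1 l2 l3 _ IH1 _ IH2]; intros k; simpl.
  - easy.
  - apply rsum_ext. intros. now rewrite IH.
  (* A transposition of arguments amounts to the commutation of two partial derivatives, that is, to
     the symmetry of [T]. *)
  - set (T := fun i j => INR (k i) * INR (decr k i j) * polar n l (decr (decr k i) j)).
    assert (HT : forall i j, T i j = T j i).
    { intros i j. destruct (Nat.eq_dec i j) as [->|Hij]; [easy|].
      unfold T. f_equal.
      - unfold decr. destruct (Nat.eq_dec i j), (Nat.eq_dec j i); try congruence. ring.
      - f_equal. apply functional_extensionality. intros t. unfold decr.
        destruct (Nat.eq_dec i t), (Nat.eq_dec j t); congruence. }
    rewrite (rsum_ext n _ (fun i => rsum n (fun j => v i * u j * T i j))).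
    2:{ intros i _. rewrite <- rsum_scal. apply rsum_ext. intros j _. unfold T. ring. }
    rewrite rsum_swap. apply rsum_ext. intros j _.
    rewrite <- rsum_scal. apply rsum_ext. intros i _. rewrite HT. unfold T. ring.
  - now rewrite IH1.
Qed.

Lemma prodR_change_factor n f g i c : (i < n)%nat ->
  (forall j, j <> i -> f j = g j) -> f i = c * g i -> prodR n f = c * prodR n g.
Proof.
  intros Hi Hfg Hc. induction n as [|n IH]; [lia|]. rewrite !prodR_S.
  destruct (Nat.eq_dec i n) as [->|Hn].
  - rewrite Hc, (prodR_ext n f g) by (intros; apply Hfg; lia). ring.
  - rewrite IH, Hfg by lia. ring.
Qed.

Lemma sumk_decr n k i : (i < n)%nat -> k i <> 0%nat -> sumk n k = S (sumk n (decr k i)).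
Proof.
  intros Hi Hk. induction n as [|n IH]; [lia|]. rewrite !sumk_S. unfold decr at 2.
  destruct (Nat.eq_dec i n) as [->|Hn].
  - enough (sumk n k = sumk n (decr k n)) by lia. clear.
    enough (H : forall j, (j <= n)%nat -> sumk j k = sumk j (decr k n)) by now apply H.
    induction j as [|j IH]; intros Hj; [easy|]. rewrite !sumk_S, IH by lia. unfold decr.
    destruct (Nat.eq_dec n j); lia.
  - rewrite IH; lia.
Qed.

Lemma prodR_1 n f : (forall i, (i < n)%nat -> f i = 1) -> prodR n f = 1.
Proof.
  induction n as [|n IH]; intros H; [easy|].
  rewrite prodR_S, IH, H by (intros; try apply H; lia). ring.
Qed.

(** Euler's identity: x_i times the i-th partial derivative reproduces the monomial with weight k_i,
    and the weights add up to the degree. *)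
Lemma polar_diag n x m : forall k, sumk n k = m ->
  polar n (repeat x m) k = INR (fact m) * prodR n (fun i => x i ^ k i).
Proof.
  induction m as [|m IH]; intros k Hk; simpl repeat.
  - simpl. rewrite prodR_1; [ring|]. intros i Hi. pose proof (sumk_term_le n k i Hi).
    now replace (k i) with 0%nat by lia.
  - simpl polar.
    rewrite (rsum_ext n _ (fun i => (INR (fact m) * prodR n (fun i => x i ^ k i)) * INR (k i))).
    + rewrite rsum_scal, <- INR_sumk, Hk, fact_simpl, mult_INR. ring.
    + intros i Hi. destruct (Nat.eq_dec (k i) 0) as [E|E]; [rewrite E; simpl; ring|].
      rewrite IH by (pose proof (sumk_decr n k i Hi E); lia).
      rewrite (prodR_change_factor n (fun i => x i ^ k i) (fun j => x j ^ decr k i j) i (x i) Hi).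
      * ring.
      * intros j Hj. unfold decr. destruct (Nat.eq_dec i j); congruence.
      * unfold decr. destruct (Nat.eq_dec i i); [|easy].
        replace (k i) with (S (k i - 1)) at 1 by lia. easy.
Qed.

(** A derivative along the i-th unit vector keeps only the i-th term, with factor k_i; repeated k_i
    times these factors make k_i!. *)
Lemma polar_units n idx : forall k,
  (forall i, In i idx -> (i < n)%nat) ->
  (forall i, (i < n)%nat -> count_occ Nat.eq_dec idx i = k i) ->
  polar n (map unit_vec idx) k = prodR n (fun i => INR (fact (k i))).
Proof.
  induction idx as [|i idx IH]; intros k Hlt Hk; simpl map; simpl polar.
  - rewrite prodR_1; [easy|]. intros i Hi. now rewrite <- Hk.
  - assert (Hi : (i < n)%nat) by (apply Hlt; now left).
    rewrite (rsum_single n _ i).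
    2:{ intros j _ Hj. unfold unit_vec. destruct (Nat.eq_dec i j); [congruence|ring]. }
    destruct (lt_dec i n); [|easy].
    unfold unit_vec at 1. destruct (Nat.eq_dec i i); [|easy].
    assert (Hki : k i = S (count_occ Nat.eq_dec idx i))
      by (rewrite <- Hk by easy; now apply count_occ_cons_eq).
    rewrite IH.
    + rewrite (prodR_change_factor n (fun j => INR (fact (k j)))
        (fun j => INR (fact (decr k i j))) i (INR (k i)) Hi); [ring| |].
      * intros j Hj. unfold decr. destruct (Nat.eq_dec i j); congruence.
      * unfold decr. destruct (Nat.eq_dec i i); [|easy]. rewrite Hki.
        rewrite fact_simpl, mult_INR. do 3 f_equal. lia.
    + intros j Hj. apply Hlt. now right.
    + intros j Hj. unfold decr.
      destruct (Nat.eq_dec i j) as [<-|Hij].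
      * lia.
      * rewrite <- Hk by easy. symmetry. now apply count_occ_cons_neq.
Qed.

Lemma count_occ_block_idx n k i :
  count_occ Nat.eq_dec (block_idx n k) i = if lt_dec i n then k i else 0%nat.
Proof.
  induction n as [|n IH]; [easy|]. rewrite block_idx_S, count_occ_app, IH.
  destruct (Nat.eq_dec n i) as [<-|Hn].
  - rewrite count_occ_repeat_eq by easy. destruct (lt_dec n n), (lt_dec n (S n)); lia.
  - rewrite count_occ_repeat_neq by easy. destruct (lt_dec i n), (lt_dec i (S n)); lia.
Qed.

(** * Continuity of the polar form *)

Lemma mult_continuous a0 b0 eps : 0 < eps -> exists delta, 0 < delta /\
  forall a b, Rabs (a - a0) < delta -> Rabs (b - b0) < delta -> Rabs (a * b - a0 * b0) < eps.
Proof.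
  intros He. set (C := Rabs a0 + Rabs b0 + 2).
  pose proof (Rabs_pos a0) as Ha0. pose proof (Rabs_pos b0) as Hb0.
  assert (HC : 0 < C) by (unfold C; lra).
  assert (Hq : 0 < eps / C) by now apply Rdiv_lt_0_compat.
  exists (Rmin 1 (eps / C)). split; [apply Rmin_pos; lra|]. intros a b Ha Hb.
  set (d := Rmin 1 (eps / C)) in *.
  assert (Hd1 : d <= 1) by apply Rmin_l. assert (Hd2 : d <= eps / C) by apply Rmin_r.
  assert (Hd : 0 < d) by now apply Rmin_pos; try lra.
  replace (a * b - a0 * b0) with ((a - a0) * (b - b0) + ((a - a0) * b0 + a0 * (b - b0))) by ring.
  eapply Rle_lt_trans; [apply Rabs_triang|].
  pose proof (Rabs_triang ((a - a0) * b0) (a0 * (b - b0))) as H1.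
  rewrite !Rabs_mult in *.
  set (A := Rabs (a - a0)) in *. set (B := Rabs (b - b0)) in *.
  assert (HA : 0 <= A) by apply Rabs_pos. assert (HB : 0 <= B) by apply Rabs_pos.
  assert (E1 : A * B <= d * 1) by (apply Rmult_le_compat; lra).
  assert (E2 : A * Rabs b0 <= d * Rabs b0) by (apply Rmult_le_compat_r; lra).
  assert (E3 : Rabs a0 * B <= Rabs a0 * d) by (apply Rmult_le_compat_l; lra).
  assert (E4 : d * C <= eps).
  { apply (Rmult_le_compat_r C) in Hd2; [|lra].
    replace (eps / C * C) with eps in Hd2 by (field; lra). easy. }
  unfold C in E4. lra.
Qed.

(** [near] is abstract so that the argument can be a pair of a head vector and a tail list. *)
Lemma rsum_continuous {A : Type} (near : R -> A -> Prop) n (f : nat -> A -> R) (f0 : nat -> R) :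
  (forall d d' a, d <= d' -> near d a -> near d' a) ->
  (forall i eps, 0 < eps -> exists delta, 0 < delta /\
     forall a, near delta a -> Rabs (f i a - f0 i) < eps) ->
  forall eps, 0 < eps -> exists delta, 0 < delta /\
     forall a, near delta a -> Rabs (rsum n (fun i => f i a) - rsum n f0) < eps.
Proof.
  intros Hmon Hf. induction n as [|n IH]; intros eps He; simpl.
  - exists 1. split; [lra|]. intros. rewrite Rminus_diag, Rabs_R0. easy.
  - destruct (IH (eps / 2) ltac:(lra)) as (d1 & Hd1 & H1).
    destruct (Hf n (eps / 2) ltac:(lra)) as (d2 & Hd2 & H2).
    exists (Rmin d1 d2). split; [now apply Rmin_pos|]. intros a Ha.
    specialize (H1 a (Hmon _ _ a (Rmin_l d1 d2) Ha)).
    specialize (H2 a (Hmon _ _ a (Rmin_r d1 d2) Ha)).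
    replace (rsum n (fun i => f i a) + f n a - (rsum n f0 + f0 n))
      with ((rsum n (fun i => f i a) - rsum n f0) + (f n a - f0 n)) by ring.
    eapply Rle_lt_trans; [apply Rabs_triang|]. lra.
Qed.

(** Implied by closeness in every l_p norm, so that one continuity proof serves all p. *)
Definition coord_close (d : R) (l' l : list vec) : Prop :=
  Forall2 (fun y x : vec => forall i, Rabs (y i - x i) < d) l' l.

Lemma coord_close_mono d d' l' l : d <= d' -> coord_close d l' l -> coord_close d' l' l.
Proof.
  intros Hd H. unfold coord_close in *. induction H as [|y x l' l Hyx _ IH]; constructor; [|easy].
  intros i. specialize (Hyx i). lra.
Qed.

Lemma polar_continuous n l : forall k eps, 0 < eps -> exists delta, 0 < delta /\
  forall l', coord_close delta l' l -> Rabs (polar n l' k - polar n l k) < eps.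
Proof.
  induction l as [|x l IH]; intros k eps He.
  - exists 1. split; [lra|]. intros l' H. inversion H. simpl. now rewrite Rminus_diag, Rabs_R0.
  - destruct (rsum_continuous (fun d (q : vec * list vec) =>
       (forall i, Rabs (fst q i - x i) < d) /\ coord_close d (snd q) l) n
      (fun i q => INR (k i) * fst q i * polar n (snd q) (decr k i))
      (fun i => INR (k i) * x i * polar n l (decr k i))) with (eps := eps) as (d & Hd & H).
    + intros d d' q Hdd [H1 H2]. split; [|now apply coord_close_mono with d].
      intros i. specialize (H1 i). lra.
    + intros i eps' He'. set (K := INR (k i)). assert (HK : 0 <= K) by apply pos_INR.
      (* [K + 1] in place of [K] keeps the quotient meaningful when [k i] is 0. *)
      destruct (mult_continuous (x i) (polar n l (decr k i)) (eps' / (K + 1))) as (d & Hd & H).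
      { apply Rdiv_lt_0_compat; lra. }
      destruct (IH (decr k i) d Hd) as (d' & Hd' & H').
      exists (Rmin d d'). split; [now apply Rmin_pos|]. intros [y l'] [H1 H2]. simpl in *.
      assert (H3 : Rabs (y i * polar n l' (decr k i) - x i * polar n l (decr k i)) < eps' / (K + 1)).
      { apply H.
        - eapply Rlt_le_trans; [apply H1|apply Rmin_l].
        - apply H'. eapply coord_close_mono; [apply Rmin_r|exact H2]. }
      rewrite !Rmult_assoc, <- Rmult_minus_distr_l, Rabs_mult, (Rabs_pos_eq K) by easy.
      set (Z := Rabs (y i * polar n l' (decr k i) - x i * polar n l (decr k i))) in *.
      assert (HZ : 0 <= Z) by apply Rabs_pos.
      apply (Rmult_lt_compat_r (K + 1)) in H3; [|lra].
      replace (eps' / (K + 1) * (K + 1)) with eps' in H3 by (field; lra). nra.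
    + easy.
    + exists d. split; [easy|]. intros l' Hl'. inversion Hl' as [|y x' l1 l2 Hy Hl1]; subst.
      apply (H (y, l1)). now split.
Qed.

Lemma polar_sym_mlin p n k m : p_valid p -> sym_mlin_form p m (fun l => polar n l k).
Proof.
  intros Hp. split; [|split].
  - intros a b u v al be _ _ _ _ _. apply polar_vlin.
  - intros l l' _ HP. now apply polar_perm.
  - intros l _ eps He. destruct (polar_continuous n l k eps He) as (d & Hd & H).
    exists d. split; [easy|]. intros l' _ Hl. apply H. clear H. unfold coord_close.
    induction Hl as [|y x l' l (r & Hr & Hrd) _ IH]; constructor; [|easy].
    intros i. eapply Rle_lt_trans; [|exact Hrd].
    apply (lp_norm_coord_le p (vsub y x)); easy.
Qed.

(** * The maximum of the monomial on the unit ball *)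

Lemma rsum_le_infinite_sum n f l :
  (forall i, 0 <= f i) -> infinite_sum f l -> rsum n f <= l.
Proof.
  intros Hf Hl.
  assert (HG : forall N, sum_f_R0 f N <= l).
  { apply growing_ineq; [|exact Hl]. intros N. simpl. specialize (Hf (S N)). lra. }
  assert (E : forall N, rsum (S N) f = sum_f_R0 f N).
  { induction N as [|N IH]; simpl in *; [ring|]. now rewrite IH. }
  destruct n as [|n].
  - simpl. specialize (HG 0%nat). specialize (Hf 0%nat). simpl in HG. lra.
  - rewrite E. apply HG.
Qed.

Lemma prodR_exp n f : prodR n (fun i => exp (f i)) = exp (rsum n f).
Proof.
  induction n as [|n IH]; [simpl; now rewrite exp_0|].
  rewrite prodR_S, IH. simpl. symmetry. apply exp_plus.
Qed.

(** This is ln u <= u - 1 at u = M b/k, multiplied by k/q. A single exponential may exceed 1; when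
    the k_i add up to M and the b_i to at most 1, the product of all of them has exponent M(sum_i
    b_i - 1)/q <= 0. *)
Lemma weighted_factor_le q M k b : 1 <= q -> 1 <= M -> 0 <= b ->
  rpow b (INR k / q) * rpow M (INR k / q)
  <= rpow (INR k) (INR k / q) * exp ((M * b - INR k) / q).
Proof.
  intros Hq HM Hb. assert (Hqi : 0 < / q) by (apply Rinv_0_lt_compat; lra).
  destruct (Nat.eq_dec k 0) as [->|Hk].
  - simpl INR. unfold Rdiv. rewrite Rmult_0_l, !rpow_0_r, Rminus_0_r, !Rmult_1_l.
    assert (0 <= M * b * / q) by (repeat apply Rmult_le_pos; lra).
    pose proof (exp_ineq1_le (M * b * / q)). lra.
  - assert (HK : 0 < INR k) by (apply lt_0_INR; lia). set (K := INR k) in *.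
    assert (HKq : 0 < K / q) by now apply Rdiv_lt_0_compat; lra.
    destruct Hb as [Hb| <-].
    + rewrite !rpow_pos by lra. unfold Rpower. rewrite <- !exp_plus.
      assert (HX : 0 < M * b / K) by (apply Rdiv_lt_0_compat; [nra|easy]).
      pose proof (ln_le_sub1 _ HX) as H. unfold Rdiv in H at 1.
      rewrite ln_mult, ln_mult, ln_Rinv in H
        by (try apply Rinv_0_lt_compat; try apply Rmult_lt_0_compat; lra).
      assert (H1 : K / q * (ln M + ln b + - ln K) <= K / q * (M * b / K - 1))
        by (apply Rmult_le_compat_l; lra).
      replace (K / q * (M * b / K - 1)) with ((M * b - K) / q) in H1 by (field; lra).
      assert (H2 : K / q * ln b + K / q * ln M <= K / q * ln K + (M * b - K) / q) by lra.
      destruct H2 as [H2| ->]; [left; now apply exp_increasing|lra].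
    + rewrite rpow_0_l by lra. rewrite Rmult_0_l.
      apply Rmult_le_pos; [apply rpow_nonneg|left; apply exp_pos].
Qed.

(** For finite p equality occurs at |x_i|^p = k_i/m, the origin of the factors k_i^(k_i/p) and
    m^(m/p) in the lower bound. *)
Lemma monomial_bound p n k x r : p_valid p -> (1 <= sumk n k)%nat ->
  lp_norm_is p x r -> r <= 1 ->
  prodR n (fun i => Rabs (x i) ^ k i) * ppow p (INR (sumk n k)) (INR (sumk n k))
  <= prodR n (fun i => ppow p (INR (k i)) (INR (k i))).
Proof.
  intros Hp Hm Hx Hr. set (m := sumk n k) in *.
  assert (HM : 1 <= INR m) by (apply (le_INR 1); lia).
  destruct p as [q|]; simpl in *.
  - set (b := fun i => rpow (Rabs (x i)) q).
    assert (Hb : rsum n b <= 1).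
    { destruct Hx as [Hr0 Hx]. apply Rle_trans with (rpow r q).
      - apply rsum_le_infinite_sum; [intros; apply rpow_nonneg|exact Hx].
      - rewrite <- (rpow_1_l q). apply rpow_le_l; lra. }
    replace (rpow (INR m) (INR m / q)) with (prodR n (fun i => rpow (INR m) (INR (k i) / q))).
    2:{ rewrite (prodR_ext n _ (fun i => exp (ln (INR m) / q * INR (k i)))).
        - rewrite prodR_exp, rsum_scal, <- INR_sumk, rpow_pos by lra. fold m.
          unfold Rpower. f_equal. field. lra.
        - intros i _. rewrite rpow_pos by lra. unfold Rpower. f_equal. field. lra. }
    rewrite <- prodR_mult.
    apply Rle_trans with (prodR n (fun i => rpow (INR (k i)) (INR (k i) / q)
        * exp ((INR m * b i - INR (k i)) / q))).
    + apply prodR_le. intros i _. split.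
      * apply Rmult_le_pos; [apply pow_le, Rabs_pos|apply rpow_nonneg].
      * replace (Rabs (x i) ^ k i) with (rpow (b i) (INR (k i) / q)).
        { apply weighted_factor_le; try easy. apply rpow_nonneg. }
        unfold b. rewrite rpow_rpow by (try apply Rabs_pos; lra).
        replace (q * (INR (k i) / q)) with (INR (k i)) by (field; lra).
        apply rpow_INR, Rabs_pos.
    + rewrite prodR_mult, prodR_exp.
      rewrite (rsum_ext n _ (fun i => INR m / q * b i + - / q * INR (k i)))
        by (intros; field; lra).
      rewrite rsum_lin, <- INR_sumk. fold m.
      rewrite <- (Rmult_1_r (prodR n (fun i => rpow (INR (k i)) (INR (k i) / q)))) at 2.
      apply Rmult_le_compat_l.
      { apply (prodR_le n (fun i => rpow (INR (k i)) (INR (k i) / q))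
          (fun i => rpow (INR (k i)) (INR (k i) / q))).
        intros. split; [apply rpow_nonneg|lra]. }
      rewrite <- exp_0.
      assert (H : INR m / q * rsum n b + - / q * INR m <= 0).
      { assert (Hmq : 0 < INR m / q) by (apply Rdiv_lt_0_compat; lra).
        replace (- / q * INR m) with (- (INR m / q)) by (field; lra). nra. }
      destruct H as [H| ->]; [left; now apply exp_increasing|lra].
  - rewrite Rmult_1_r, (prodR_1 n (fun _ => 1)) by easy.
    rewrite <- (prodR_1 n (fun _ => 1)) by easy. apply prodR_le. intros i _.
    split; [apply pow_le, Rabs_pos|]. rewrite <- (pow1 (k i)). apply pow_incr.
    split; [apply Rabs_pos|]. pose proof (lp_norm_coord_le PInf x r i I Hx). lra.
Qed.

Lemma unit_vec_norm p i : p_valid p -> lp_norm_is p (unit_vec i) 1.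
Proof.
  intros Hp. split; [lra|]. destruct p as [q|]; simpl in Hp.
  - rewrite rpow_1_l.
    assert (E : forall n, sum_f_R0 (fun j => rpow (Rabs (unit_vec i j)) q) n
                   = if lt_dec i (S n) then 1 else 0).
    { assert (E0 : forall j, rpow (Rabs (unit_vec i j)) q = if Nat.eq_dec i j then 1 else 0).
      { intros j. unfold unit_vec. destruct (Nat.eq_dec i j).
        - now rewrite Rabs_R1, rpow_1_l.
        - rewrite Rabs_R0, rpow_0_l; lra. }
      induction n as [|n IH]; simpl sum_f_R0; rewrite E0.
      - destruct (Nat.eq_dec i 0), (lt_dec i 1); try lia; easy.
      - rewrite IH. destruct (lt_dec i (S n)), (Nat.eq_dec i (S n)), (lt_dec i (S (S n)));
          try lia; ring. }
    intros eps He. exists i. intros n Hn. rewrite E.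
    destruct (lt_dec i (S n)); [|lia]. unfold Rdist. now rewrite Rminus_diag, Rabs_R0.
  - split.
    + intros t [j ->]. unfold unit_vec. destruct (Nat.eq_dec i j); [rewrite Rabs_R1|rewrite Rabs_R0]; lra.
    + intros b Hb. apply Hb. exists i. unfold unit_vec. destruct (Nat.eq_dec i i); [|easy].
      now rewrite Rabs_R1.
Qed.

Lemma ppow_pos p j : 0 < ppow p (INR j) (INR j).
Proof.
  destruct p as [q|]; simpl; [|lra]. destruct j as [|j].
  - simpl INR. unfold Rdiv. rewrite Rmult_0_l, rpow_0_r. lra.
  - apply rpow_gt0, lt_0_INR. lia.
Qed.

Lemma lower_bound_le_admissible p n k c : p_valid p -> (1 <= sumk n k)%nat ->
  admissible p n k c -> lower_bound p n k (sumk n k) <= c.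
Proof.
  intros Hp Hm Hc. set (m := sumk n k) in *. pose (L := (fun l => polar n l k) : form).
  set (A := prodR n (fun i => INR (fact (k i)))).
  set (B := prodR n (fun i => ppow p (INR (k i)) (INR (k i)))).
  pose proof (ppow_pos p m) as HQ. set (Q := ppow p (INR m) (INR m)) in *.
  assert (HA : 0 < A) by (apply prodR_pos; intros; apply INR_fact_lt_0).
  assert (HB : 0 < B) by (apply prodR_pos; intros; apply ppow_pos).
  pose proof (INR_fact_lt_0 m) as Hf.
  assert (HU : is_upper_bound (hat_values p m L) (INR (fact m) * (B / Q))).
  { intros t (x & r & Hx & Hr & ->). unfold L. rewrite polar_diag by easy.
    rewrite Rabs_mult, Rabs_pos_eq by lra. apply Rmult_le_compat_l; [lra|].
    rewrite prodR_Rabs, (prodR_ext n _ (fun i => Rabs (x i) ^ k i))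
      by (intros; symmetry; apply RPow_abs).
    apply Rmult_le_reg_r with Q; [easy|]. unfold Rdiv. rewrite Rmult_assoc, Rinv_l, Rmult_1_r by lra.
    now apply monomial_bound with r. }
  destruct (completeness (hat_values p m L)) as [N HN].
  { eexists; exact HU. }
  { exists (Rabs (L (repeat (fun _ => 0) m))), (fun _ => 0), 0.
    split; [now apply lp_norm_zero|]. split; [lra|easy]. }
  pose proof (hat_lub_nonneg p m L N Hp HN) as HN0.
  assert (HNU : N <= INR (fact m) * (B / Q)) by now apply HN.
  assert (H : A <= c * N).
  { pose proof (Hc L (polar_sym_mlin p n k m Hp) N HN unit_vec) as H.
    rewrite args_of_map in H. unfold L in H at 1. rewrite polar_units in H.
    - fold A in H. rewrite Rabs_pos_eq in H by lra. apply H.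
      + intros i _. now apply unit_vec_norm.
      + intros i j _ _ Hij t. unfold unit_vec.
        destruct (Nat.eq_dec i t), (Nat.eq_dec j t); (now left) || (now right) || congruence.
    - apply block_idx_lt.
    - intros i Hi. rewrite count_occ_block_idx. destruct (lt_dec i n); easy. }
  (* Replacing [N] by its upper bound requires c >= 0; positivity follows from 0 < A <= c N and N >=
     0. *)
  assert (Hc0 : 0 < c).
  { destruct (Rlt_le_dec 0 c) as [|Hc0]; [easy|]. nra. }
  assert (H2 : A <= c * (INR (fact m) * (B / Q))).
  { eapply Rle_trans; [exact H|]. apply Rmult_le_compat_l; lra. }
  unfold lower_bound. fold A B Q.
  apply Rmult_le_reg_r with (INR (fact m) * (B / Q)).
  { apply Rmult_lt_0_compat; [easy|]. now apply Rdiv_lt_0_compat. }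
  replace (A / B * Q / INR (fact m) * (INR (fact m) * (B / Q))) with A by (field; lra). easy.
Qed.

(** * Existence of the least constant *)

(** The infimum is minus the supremum of the negatives. It is admissible: for N > 0 each condition
    reads v/N <= c and survives the infimum, and for N = 0 the constant [c1] already forces v <=
    0. *)
Lemma is_cp_exists p n k c1 c2 : p_valid p -> admissible p n k c1 ->
  (forall c, admissible p n k c -> c2 <= c) -> exists c, is_cp p n k c.
Proof.
  intros Hp H1 H2.
  destruct (completeness (fun t => admissible p n k (- t))) as [M [HM1 HM2]].
  - exists (- c2). intros t Ht. specialize (H2 _ Ht). lra.
  - exists (- c1). now rewrite Ropp_involutive.
  - exists (- M). split.
    + intros L HL N HN x Hx Hd.
      pose proof (hat_lub_nonneg p (sumk n k) L N Hp HN) as HN0.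
      set (v := Rabs (L (args_of n k x))).
      destruct HN0 as [HN0| <-].
      * assert (HMv : M <= - (v / N)).
        { apply HM2. intros t Ht. pose proof (Ht L HL N HN x Hx Hd) as H. fold v in H.
          apply (Rmult_le_compat_r (/ N)) in H; [|left; now apply Rinv_0_lt_compat].
          rewrite Rmult_assoc, Rinv_r, Rmult_1_r in H by lra. unfold Rdiv. lra. }
        replace v with (v / N * N) by (field; lra). apply Rmult_le_compat_r; lra.
      * pose proof (H1 L HL 0 HN x Hx Hd) as H. fold v in H. lra.
    + intros c' Hc'. assert (- c' <= M); [|lra]. apply HM1. now rewrite Ropp_involutive.
Qed.

Theorem mainTheorem6 (p : extp) (m n : nat) (k : nat -> nat) :
  p_valid p -> (1 <= m)%nat -> sumk n k = m ->
  exists c, is_cp p n k c /\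
    lower_bound p n k m <= c /\ c <= upper_bound p n k m.
Proof.
  intros Hp Hm <-. pose proof (upper_bound_admissible p n k Hp Hm) as HU.
  destruct (is_cp_exists p n k _ (lower_bound p n k (sumk n k)) Hp HU) as [c Hc].
  { intros c Hc. now apply lower_bound_le_admissible. }
  exists c. split; [easy|]. destruct Hc as [Hc Hmin].
  split; [now apply lower_bound_le_admissible|now apply Hmin].
Qed.
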